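(* Let $\Omega\subset\mathbb{R}^n$ be an open domain and let $G: L^2(\Omega; \mathbb{R}^m) \to (-\infty,\infty]$ have the form $G(u)=\int_\Omega g(x,u(x))\,dx$ for some regular integrand $g$. Then for $u,\xi,\Delta\xi\in L^2(\Omega;\mathbb{R}^m)$ the regular coderivative of the convex subdifferential $\partial G$ at $u$ for $\xi$ in the direction $\Delta\xi$ is given by $$\widehat D^*[\partial G](u|\xi)(\Delta\xi)=\{\Delta u\in L^2(\Omega;\mathbb{R}^m)\mid \Delta u(x)\in \widehat D^*[\partial g(x,\cdot)](u(x)|\xi(x))(\Delta\xi(x)) \text{ for a.e. } x\in\Omega\}.$$ Likewise, for $\Delta u\in L^2(\Omega;\mathbb{R}^m)$, the graphical derivative at $u$ for $\xi$ in the direction $\Delta u$ is given by $$D[\partial G](u|\xi)(\Delta u)=\{\Delta \xi\in L^2(\Omega;\mathbb{R}^m)\mid \Delta \xi(x)\in D[\partial g(x,\cdot)](u(x)|\xi(x))(\Delta u(x)) \text{ for a.e. } x\in\Omega\}.$$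
   Context: Hilbert spaces are identified with their duals. For a subset $U$ of a Hilbert space $X$ and $u\in U$: $\widehat N(u;U)=\{z\in X \mid \limsup_{U\ni u'\to u}\frac{\langle z,u'-u\rangle}{\|u'-u\|}\le 0\}$ and $T(u;U)=\{z\mid \exists\,\tau^i\searrow 0,\ u^i\in U: z=\lim_i (u^i-u)/\tau^i\}$ (both understood as empty if $u\notin U$). For a set-valued $R:Q\rightrightarrows W$ between Hilbert spaces with $\operatorname{graph}R=\{(q,w)\mid w\in R(q)\}$: - regular coderivative $\widehat D^*R(q|w)(\Delta w)=\{\Delta q\in Q\mid(\Delta q,-\Delta w)\in\widehat N((q,w);\operatorname{graph}R)\}$; - graphical derivative $DR(q|w)(\Delta q)=\{\Delta w\in W\mid(\Delta q,\Delta w)\in T((q,w);\operatorname{graph}R)\}$. A set $U$ is geometrically derivable if for every $u\in U$ and $z\in T(u;U)$ there are $\varepsilon>0$ and a curve $\xi:[0,\varepsilon]\to U$ with $\xi(0)=u$ and $\lim_{t\searrow0}(\xi(t)-\xi(0))/t=z$. $R$ is proto-differentiable if $\operatorname{graph}R$ is geometrically derivable. An integrand $g:\Omega\times\mathbb{R}^m\to(-\infty,\infty]$ is regular if (i) it is normal, i.e. the epigraphical mapping $x\mapsto\operatorname{epi}g(x,\cdot)\subset\mathbb{R}^m\times\mathbb{R}$ is closed-valued and measurable; (ii) $g(x,\cdot)$ is proper and convex for each $x\in\Omega$; (iii) $z\mapsto\partial_z g(x,z)$ (convex subdifferential in $z$) is proto-differentiable for a.e. $x\in\Omega$. $\partial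 g(x,\cdot)$ denotes the convex subdifferential with respect to the second variable. It is assumed that $G$ is proper, i.e. there is at least one $u_0\in\operatorname{dom}G$. *)

(* Defs.v *)
From HB Require Import structures.
From mathcomp Require Import all_boot all_order all_algebra.
From mathcomp Require Import all_classical all_reals all_analysis.
From mathcomp Require Import measurable_realfun ring lra.
Import Order.TTheory GRing.Theory Num.Theory.
Import numFieldNormedType.Exports.

Set Implicit Arguments.
Unset Strict Implicit.
Unset Printing Implicit Defensive.

Local Open Scope classical_set_scope.
Local Open Scope ring_scope.

(* None of the definitions below depends on completeness, so it is not part of
   this structure; the instances are R^m with the Euclidean inner product,
   products, and L^2(Omega; R^m). *)

HB.mixin Record isInnerProduct (R : realType) V & GRing.Lmodule R V := {
  inner : V -> V -> R ;
  innerC : forall u v, inner u v = inner v u ;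
  innerDl : forall u v w, inner (u + v) w = inner u w + inner v w ;
  innerZl : forall a u v, inner (a *: u) v = a * inner u v ;
  inner_ge0 : forall u, 0 <= inner u u ;
  inner_eq0 : forall u, inner u u = 0 -> u = 0
}.

#[short(type=innerProductType)]
HB.structure Definition InnerProduct (R : realType) :=
  {V of isInnerProduct R V & GRing.Lmodule R V}.

Lemma inner_sqD (R : realType) (V : innerProductType R) a (u v : V) :
  inner (a *: u + v) (a *: u + v) =
  a ^+ 2 * inner u u + (a *+ 2 * inner u v + inner v v).
Proof.
rewrite innerDl innerZl [inner u (_ + _)]innerC [inner v (_ + _)]innerC.
by rewrite !innerDl !innerZl (innerC v u); ring.
Qed.

Section rV_inner.
Context (R : realType) (m : nat).

Definition rV_inner (u v : 'rV[R]_m) : R := \sum_(i < m) u 0 i * v 0 i.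

Let rV_innerC u v : rV_inner u v = rV_inner v u.
Proof. by apply: eq_bigr => i _; rewrite mulrC. Qed.

Let rV_innerDl u v w : rV_inner (u + v) w = rV_inner u w + rV_inner v w.
Proof. by rewrite -big_split; apply: eq_bigr => i _; rewrite mxE mulrDl. Qed.

Let rV_innerZl a u v : rV_inner (a *: u) v = a * rV_inner u v.
Proof. by rewrite mulr_sumr; apply: eq_bigr => i _; rewrite mxE mulrA. Qed.

Let rV_inner_ge0 u : 0 <= rV_inner u u.
Proof. by apply: sumr_ge0 => i _; rewrite -expr2 sqr_ge0. Qed.

Let rV_inner_eq0 u : rV_inner u u = 0 -> u = 0.
Proof.
move=> /eqP; rewrite psumr_eq0; last by move=> i _; rewrite -expr2 sqr_ge0.
move=> /allP u0; apply/rowP => i; rewrite mxE.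
by have /= := u0 i (mem_index_enum _); rewrite -expr2 sqrf_eq0 => /eqP.
Qed.

HB.instance Definition _ := isInnerProduct.Build R 'rV[R]_m
  rV_innerC rV_innerDl rV_innerZl rV_inner_ge0 rV_inner_eq0.

End rV_inner.

Section prod_inner.
Context (R : realType) (V W : innerProductType R).

Definition prod_inner (p q : V * W) : R := inner p.1 q.1 + inner p.2 q.2.

Let prod_innerC p q : prod_inner p q = prod_inner q p.
Proof. by rewrite /prod_inner innerC [inner p.2 _]innerC. Qed.

Let prod_innerDl p q r : prod_inner (p + q) r = prod_inner p r + prod_inner q r.
Proof. by rewrite /prod_inner !innerDl addrACA. Qed.

Let prod_innerZl a p q : prod_inner (a *: p) q = a * prod_inner p q.
Proof. by rewrite /prod_inner !innerZl mulrDr. Qed.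

Let prod_inner_ge0 p : 0 <= prod_inner p p.
Proof. by rewrite addr_ge0// inner_ge0. Qed.

Let prod_inner_eq0 p : prod_inner p p = 0 -> p = 0.
Proof.
move=> /eqP; rewrite paddr_eq0 ?inner_ge0// => /andP[/eqP p1 /eqP p2].
by case: p p1 p2 => a b /= /inner_eq0 -> /inner_eq0 ->.
Qed.

HB.instance Definition _ := isInnerProduct.Build R (V * W)%type
  prod_innerC prod_innerDl prod_innerZl prod_inner_ge0 prod_inner_eq0.

End prod_inner.

Section variational.
Context (R : realType).

Definition hnorm (V : innerProductType R) (u : V) : R := Num.sqrt (inner u u).

Section cones.
Context (V : innerProductType R).
Implicit Types (U : set V) (u v z : V).

Definition limsup_quotient U u z : \bar R :=
  ereal_inf [set ereal_sup
      [set (inner z (u' - u) / hnorm (u' - u))%:E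
        | u' in [set u' | U u' /\ 0 < hnorm (u' - u) < delta]]
    | delta in [set delta : R | 0 < delta]].

Definition regular_normal_cone U u : set V :=
  [set z | U u /\ (limsup_quotient U u z <= 0)%E].

Definition tangent_cone U u : set V :=
  [set z | U u /\ exists (tau : nat -> R) (v : nat -> V),
    [/\ forall i, 0 < tau i, tau @ \oo --> (0 : R), forall i, U (v i) &
        hnorm ((tau i)^-1 *: (v i - u) - z) @[i --> \oo] --> (0 : R)]].

(* A curve [0, eps] -> U is a total function [xi] whose values outside [0, eps]
   are irrelevant. *)
Definition geometrically_derivable U := forall u z, U u -> tangent_cone U u z ->
  exists (eps : R) (xi : R -> V),
    [/\ 0 < eps, forall t, 0 <= t <= eps -> U (xi t), xi 0 = u &
        hnorm (t^-1 *: (xi t - xi 0) - z) @[t --> 0^'+] --> (0 : R)].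

Definition proper_ereal (f : V -> \bar R) :=
  (forall v, f v != -oo%E) /\ exists v, (f v < +oo)%E.

Definition convex_ereal (f : V -> \bar R) := forall u v (t : R), 0 < t < 1 ->
  (f (t *: u + (1 - t) *: v)%R <= t%:E * f u + (1 - t)%R%:E * f v)%E.

Definition subdifferential (f : V -> \bar R) u : set V :=
  [set xi | forall v, (f u + (inner xi (v - u)%R)%:E <= f v)%E].

End cones.

Section setvalued.
Context (Q W : innerProductType R).
Implicit Types (S : Q -> set W) (q : Q) (w : W).

Definition graph S : set (Q * W) := [set qw | S qw.1 qw.2].

Definition regular_coderivative S q w (dw : W) : set Q :=
  [set dq | regular_normal_cone (graph S) (q, w) (dq, - dw)].

Definition graphical_derivative S q w (dq : Q) : set W :=
  [set dw | tangent_cone (graph S) (q, w) (dq, dw)].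

Definition proto_differentiable S := geometrically_derivable (graph S).

End setvalued.

End variational.

Section lebesgue_Rn.
Context (R : realType) (n : nat).
Local Notation box_ends := ('rV[R]_n * 'rV[R]_n)%type.
Implicit Types (ab : box_ends) (A : set 'rV[R]_n).
Local Open Scope ereal_scope.

Definition box ab : set 'rV[R]_n :=
  [set x | forall i, (ab.1 0 i <= x 0 i <= ab.2 0 i)%R].

Definition box_vol ab : \bar R := (\prod_(i < n) (ab.2 0 i - ab.1 0 i))%:E.

(* Countable sets of boxes instead of sequences of boxes: every box has volume 1
   when [n = 0], where [set0] must nevertheless have outer measure 0. *)
Definition box_cover A : set (set box_ends) :=
  [set C | [/\ countable C, forall ab, C ab -> forall i, (ab.1 0 i <= ab.2 0 i)%R &
               A `<=` \bigcup_(ab in C) box ab]].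

Definition lebesgue_outer A : \bar R :=
  ereal_inf [set \esum_(ab in C) box_vol ab | C in box_cover A].

Lemma box_vol_ge0 ab : (forall i, (ab.1 0 i <= ab.2 0 i)%R) -> 0 <= box_vol ab.
Proof. by move=> h; rewrite lee_fin prodr_ge0// => i _; rewrite subr_ge0. Qed.

Let outer0 : lebesgue_outer set0 = 0.
Proof.
apply/eqP; rewrite eq_le; apply/andP; split.
  by apply: ereal_inf_lbound; exists set0; [split|rewrite esum_set0].
apply: le_ereal_inf_tmp => _ [C [_ Cab _] <-].
by apply: esum_ge0 => ab /Cab; exact: box_vol_ge0.
Qed.

Let outer_ge0 A : 0 <= lebesgue_outer A.
Proof.
apply: le_ereal_inf_tmp => _ [C [_ Cab _] <-].
by apply: esum_ge0 => ab /Cab; exact: box_vol_ge0.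
Qed.

Let le_outer : {homo lebesgue_outer : A B / A `<=` B >-> A <= B}.
Proof.
move=> A B AB; apply: ereal_inf_le_tmp => _ [C [cC Cab BC] <-].
by exists C => //; split => //; exact: subset_trans AB BC.
Qed.

Let outer_sigma_subadditive : sigma_subadditive lebesgue_outer.
Proof.
move=> A; have [[i ioo]|] := pselect (exists i, lebesgue_outer (A i) = +oo).
  rewrite (eseries_pinfty _ _ ioo) ?leey// => k _.
  by rewrite -ltNye (lt_le_trans _ (outer_ge0 _)).
rewrite -forallNE => Aoo.
suff add2e (e : {posnum R}) : lebesgue_outer (\bigcup_n A n) <=
    \sum_(i <oo) lebesgue_outer (A i) + e%:num%:E.
  by apply/lee_addgt0Pr => _/posnumP[].
rewrite (le_trans _ (epsilon_trick _ _ _))//.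
have [C PC] : {C : nat -> set box_ends & forall k, box_cover (A k) (C k) /\
    \esum_(ab in C k) box_vol ab <= lebesgue_outer (A k) + (e%:num / (2 ^ k.+1)%:R)%:E}.
  apply: (@choice _ _ (fun k D => box_cover (A k) D /\
    \esum_(ab in D) box_vol ab <= lebesgue_outer (A k) + (e%:num / (2 ^ k.+1)%:R)%:E)).
  move=> k.
  have fk : lebesgue_outer (A k) \is a fin_num.
    by rewrite ge0_fin_numE// ltey; apply/eqP.
  have en1 : (0 < e%:num / (2 ^ k.+1)%:R :> R)%R by [].
  have [_ [D AD <-] hD] := lb_ereal_inf_adherent en1 fk.
  by exists D; split => //; exact/ltW.
have C0 k ab : C k ab -> 0 <= box_vol ab.
  by move=> Cab; apply: box_vol_ge0; have [[_ + _] _] := PC k; apply.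
pose D := seqDU C.
have DC : \bigcup_k C k = \bigcup_k D k by exact: seqDU_bigcup_eq.
have subDC k : D k `<=` C k by exact: subset_seqDU.
apply: (@le_trans _ _ (\esum_(ab in \bigcup_k D k) box_vol ab)).
  apply: ereal_inf_lbound; exists (\bigcup_k D k) => //; split.
  - rewrite -DC; apply: bigcup_countable => // k _.
    by have [[]] := PC k.
  - by move=> ab [k _ /subDC Cab]; have [[_ + _] _] := PC k; apply.
  - move=> x [k _ Akx]; have [[_ _ /(_ _ Akx)[ab Cab abx]] _] := PC k.
    by exists ab => //; rewrite -DC; exists k.
rewrite esum_bigcup; last 2 first.
- move=> i j _ _; exact: (trivIset_seqDU C).
- by move=> ab [k _ /subDC]; exact: C0.
rewrite nneseries_esumT//; last by move=> k; rewrite adde_ge0.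
apply: le_esum => k _; apply: le_trans (PC k).2.
rewrite [leLHS]esum_mkcond [leRHS]esum_mkcond; apply: le_esum => ab _.
case: ifPn => [/set_mem /subDC Cab|_]; first by rewrite mem_set.
by case: ifPn => // /set_mem; exact: C0.
Qed.

HB.instance Definition _ := isOuterMeasure.Build R 'rV[R]_n lebesgue_outer
  outer0 outer_ge0 le_outer outer_sigma_subadditive.

(* The measurable sets are the Lebesgue sets rather than the Borel sets, so the
   measure is complete. *)
Definition lebesgueRn := caratheodory_type lebesgue_outer.

HB.instance Definition _ := Measurable.on lebesgueRn.

Definition lebesgueRn_measure (A : set lebesgueRn) : \bar R := lebesgue_outer A.

Let measure0 : lebesgueRn_measure set0 = 0.
Proof. exact: caratheodory_measure0. Qed.

Let measure_ge0 A : 0 <= lebesgueRn_measure A.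
Proof. exact: caratheodory_measure_ge0. Qed.

Let measure_semi_sigma_additive : semi_sigma_additive lebesgueRn_measure.
Proof. exact: caratheodory_measure_sigma_additive. Qed.

HB.instance Definition _ := isMeasure.Build _ lebesgueRn R lebesgueRn_measure
  measure0 measure_ge0 measure_semi_sigma_additive.

End lebesgue_Rn.

Arguments lebesgueRn_measure : clear implicits.

(* L^2(D; R^m): square-integrable functions modulo almost-everywhere equality. A function on
   [D] is represented by its extension by zero, so integrals over the whole
   space are integrals over [D]. *)

Section square_integrable.
Context d (T : measurableType d) (R : realType).
Variables (mu : {measure set T -> \bar R}) (D : set T) (m : nat).

Definition square_integrable (f : T -> 'rV[R]_m) : Prop :=
  [/\ forall x, ~ D x -> f x = 0,
      forall j, measurable_fun setT (fun x => f x 0 j) &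
      (\int[mu]_x (inner (f x) (f x))%:E < +oo)%E].

Definition sqint : {pred T -> 'rV[R]_m} := fun f => `[< square_integrable f >].

Lemma measurable_inner (f g : T -> 'rV[R]_m) :
  (forall j, measurable_fun setT (fun x => f x 0 j)) ->
  (forall j, measurable_fun setT (fun x => g x 0 j)) ->
  measurable_fun setT (fun x => inner (f x) (g x)).
Proof.
move=> mf mg.
by apply: measurable_sum => i; exact: measurable_funM.
Qed.

Lemma inner_le (u v : 'rV[R]_m) :
  `|inner u v| <= inner u u + inner v v.
Proof.
rewrite -big_split/=; apply: le_trans (ler_norm_sum _ _ _) _.
apply: ler_sum => i _; rewrite normrM -!expr2.
rewrite -[u 0 i ^+ 2]real_normK ?num_real// -[v 0 i ^+ 2]real_normK ?num_real//.
by have := normr_ge0 (u 0 i); have := normr_ge0 (v 0 i); nra.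
Qed.

Lemma integrable_inner f g : square_integrable f -> square_integrable g ->
  mu.-integrable setT (fun x => (inner (f x) (g x))%:E).
Proof.
move=> [_ mf f2] [_ mg g2].
have mi (h : T -> 'rV[R]_m) : (forall j, measurable_fun setT (fun x => h x 0 j)) ->
    measurable_fun setT (fun x => (inner (h x) (h x))%:E).
  by move=> mh; apply/measurable_EFinP; exact: measurable_inner.
apply/integrableP; split; first by apply/measurable_EFinP; exact: measurable_inner.
apply: (@le_lt_trans _ _ (\int[mu]_x ((inner (f x) (f x))%:E + (inner (g x) (g x))%:E))%E).
  apply: ge0_le_integral => //.
  - by apply: measurableT_comp => //; apply/measurable_EFinP; exact: measurable_inner.
  - by apply: emeasurable_funD; exact: mi.
  - by move=> x _; rewrite -EFinD lee_fin; exact: inner_le.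
rewrite ge0_integralD//; first by rewrite lte_add_pinfty.
- by move=> x _; rewrite lee_fin inner_ge0.
- exact: mi.
- by move=> x _; rewrite lee_fin inner_ge0.
- exact: mi.
Qed.

Lemma sqint_submod_closed : submod_closed sqint.
Proof.
split.
  apply/asboolP; split => //.
  rewrite (_ : (fun _ => _) = cst 0%E) ?integral0 ?ltry//.
  apply/funext => x /=; have -> : (0 : T -> 'rV[R]_m) x = 0 *: 0 by rewrite scale0r.
  by rewrite innerZl mul0r.
move=> a f g /asboolP sf /asboolP sg; apply/asboolP; split.
  - case: sf => f0 _ _; case: sg => g0 _ _ x Dx.
  rewrite (_ : (_ + _) x = a *: f x + g x)//.
  by rewrite f0// g0// scaler0 addr0.
- case: sf => _ mf _; case: sg => _ mg _ j.
  rewrite (_ : (fun _ => _) = (fun x => a * f x 0 j + g x 0 j)); last first.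
    by apply/funext => x; rewrite !mxE.
  by apply: measurable_funD => //; exact: measurable_funM.
- rewrite (_ : (fun _ => _) = (fun x => (a ^+ 2)%:E * (inner (f x) (f x))%:E +
    ((a *+ 2)%:E * (inner (f x) (g x))%:E + (inner (g x) (g x))%:E))%E); last first.
    by apply/funext => x; rewrite -!EFinM -!EFinD -inner_sqD.
  have iff := integrable_inner sf sf; have ifg := integrable_inner sf sg.
  have igg := integrable_inner sg sg.
  apply: (integral_fune_lt_pinfty measurableT).
  apply: integrableD => //; first exact: integrableZl.
  by apply: integrableD => //; exact: integrableZl.
Qed.

HB.instance Definition _ := GRing.isSubmodClosed.Build R (T -> 'rV[R]_m) sqint
  sqint_submod_closed.

Record sqfun := Sqfun { sqfun_fun :> T -> 'rV[R]_m ; _ : sqfun_fun \in sqint }.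

HB.instance Definition _ := [isSub for sqfun_fun].
HB.instance Definition _ := [Choice of sqfun by <:].
HB.instance Definition _ := [SubChoice_isSubLmodule of sqfun by <:].

Lemma sqfunP (f : sqfun) : square_integrable f.
Proof. exact/asboolP/(valP f). Qed.

Definition ae_null : {pred sqfun} := fun f => `[< {ae mu, forall x, f x = 0} >].

Lemma ae_null_zmod_closed : zmod_closed ae_null.
Proof.
split; first by apply/asboolP; apply: aeW.
move=> f g /asboolP f0 /asboolP g0; apply/asboolP.
apply: filterS2 f0 g0 => x fx gx.
by rewrite (_ : (_ - _ : sqfun) x = f x - g x)// fx gx subr0.
Qed.

HB.instance Definition _ := GRing.isZmodClosed.Build sqfun ae_null
  ae_null_zmod_closed.

Definition L2 : Type := Quotient.quot ae_null.

HB.instance Definition _ := Choice.on L2.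
HB.instance Definition _ := GRing.Zmodule.on L2.
HB.instance Definition _ := EqQuotient.on L2.

(* The coercion picks a representative of the class. *)
Definition L2_fun (u : L2) : T -> 'rV[R]_m := repr u.
Coercion L2_fun : L2 >-> Funclass.

End square_integrable.

Section L2_hilbert.
Context d (T : measurableType d) (R : realType).
Variables (mu : {measure set T -> \bar R}) (D : set T) (m : nat).
Local Open Scope quotient_scope.
Local Notation sqfun := (sqfun mu D m).
Local Notation L2 := (L2 mu D m).

Lemma L2_pi (f : sqfun) : {ae mu, forall x, (\pi_L2 f : L2) x = f x}.
Proof.
have /eqP := reprK (\pi_L2 f : L2); rewrite -Quotient.idealrBE => /asboolP.
by apply: filterS => x /eqP; rewrite subr_eq0 => /eqP.
Qed.

Lemma L2_ext (u v : L2) : {ae mu, forall x, u x = v x} -> u = v.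
Proof.
move=> uv; rewrite -[u]reprK -[v]reprK; apply/eqP.
rewrite -Quotient.idealrBE; apply/asboolP.
by apply: filterS uv => x uvx; apply/eqP; rewrite subr_eq0; apply/eqP.
Qed.

Lemma L2D (u v : L2) : {ae mu, forall x, (u + v : L2) x = u x + v x}.
Proof.
have uvE : u + v = \pi_L2 (repr u + repr v : sqfun).
  by rewrite -{1}[u]reprK -{1}[v]reprK; rewrite [RHS]Quotient.pi_add.
by apply: filterS (L2_pi (repr u + repr v)) => x; rewrite -uvE.
Qed.

Definition L2_scale (a : R) (u : L2) : L2 := \pi_L2 (a *: repr u : sqfun).

Lemma L2Z a (u : L2) : {ae mu, forall x, L2_scale a u x = a *: u x}.
Proof. exact: L2_pi. Qed.

Let scaleA a b (u : L2) : L2_scale a (L2_scale b u) = L2_scale (a * b) u.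
Proof.
apply: L2_ext; apply: filterS3 (L2Z a (L2_scale b u)) (L2Z b u) (L2Z (a * b) u).
by move=> x -> -> ->; rewrite scalerA.
Qed.

Let scale1 : left_id 1 L2_scale.
Proof.
by move=> u; apply: L2_ext; apply: filterS (L2Z 1 u) => x ->; rewrite scale1r.
Qed.

Let scaleDr : right_distributive L2_scale +%R.
Proof.
move=> a u v; apply: L2_ext.
have auav : {ae mu, forall x, (L2_scale a u + L2_scale a v : L2) x = a *: u x + a *: v x}.
  apply: filterS3 (L2D (L2_scale a u) (L2_scale a v)) (L2Z a u) (L2Z a v).
  by move=> x -> -> ->.
apply: filterS3 (L2Z a (u + v)) (L2D u v) auav.
by move=> x -> -> ->; rewrite scalerDr.
Qed.

Let scaleDl v : {morph L2_scale^~ v : a b / a + b}.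
Proof.
move=> a b; apply: L2_ext.
have avbv : {ae mu, forall x, (L2_scale a v + L2_scale b v : L2) x = a *: v x + b *: v x}.
  apply: filterS3 (L2D (L2_scale a v) (L2_scale b v)) (L2Z a v) (L2Z b v).
  by move=> x -> -> ->.
by apply: filterS2 (L2Z (a + b) v) avbv => x -> ->; rewrite scalerDl.
Qed.

HB.instance Definition _ := GRing.Zmodule_isLmodule.Build R L2
  scaleA scale1 scaleDr scaleDl.

Definition L2_inner (u v : L2) : R := \int[mu]_x inner (u x) (v x).

Lemma integrable_L2_inner (u v : L2) :
  mu.-integrable setT (fun x => (inner (u x) (v x))%:E).
Proof. by apply: integrable_inner; exact: sqfunP. Qed.

Let ae_eq_Rintegral (f h : T -> R) :
  measurable_fun setT f -> measurable_fun setT h ->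
  {ae mu, forall x, f x = h x} -> \int[mu]_x f x = \int[mu]_x h x.
Proof.
move=> mf mh fh; congr fine; apply: ae_eq_integral => //.
- exact/measurable_EFinP.
- exact/measurable_EFinP.
- by apply: filterS fh => x -> _.
Qed.

Let L2_innerC u v : L2_inner u v = L2_inner v u.
Proof. by rewrite /L2_inner; under eq_Rintegral do rewrite innerC. Qed.

Let mL2 (u v : L2) : measurable_fun setT (fun x => inner (u x) (v x)).
Proof. exact/measurable_EFinP/measurable_int/integrable_L2_inner. Qed.

Let L2_innerDl u v w : L2_inner (u + v) w = L2_inner u w + L2_inner v w.
Proof.
rewrite /L2_inner -RintegralD//; [|exact: integrable_L2_inner..].
apply: ae_eq_Rintegral => //; first exact: measurable_funD.
by apply: filterS (L2D u v) => x ->; rewrite innerDl.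
Qed.

Let L2_innerZl a u v : L2_inner (a *: u) v = a * L2_inner u v.
Proof.
rewrite /L2_inner -RintegralZl//; last exact: integrable_L2_inner.
apply: ae_eq_Rintegral => //; first exact: measurable_funM.
by apply: filterS (L2Z a u) => x ->; rewrite innerZl.
Qed.

Let L2_inner_ge0 u : 0 <= L2_inner u u.
Proof. by apply: Rintegral_ge0 => x _; exact: inner_ge0. Qed.
Let L2_inner_eq0 u : L2_inner u u = 0 -> u = 0.
Proof.
move=> uu0; have u0 : {ae mu, forall x, u x = 0}.
  have [+ _] := @ae_eq_integral_abs _ _ _ mu _ measurableT
    (fun x => (inner (u x) (u x))%:E) (measurable_int mu (integrable_L2_inner u u)).
  under eq_integral do rewrite abse_EFin ger0_norm ?inner_ge0//.
  rewrite -[X in X = 0%R -> _]fineK; last exact/integrable_fin_num/integrable_L2_inner.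
  move/(_ (congr1 EFin uu0)); apply: filterS => x /(_ I) [].
  exact: inner_eq0.
apply: (eq_trans _ (scale0r u)); apply: L2_ext.
by apply: filterS2 u0 (L2Z 0 u) => x -> ->; rewrite scaler0.
Qed.


HB.instance Definition _ := isInnerProduct.Build R L2
  L2_innerC L2_innerDl L2_innerZl L2_inner_ge0 L2_inner_eq0.

End L2_hilbert.

Notation L2Rn Omega m := (L2 (lebesgueRn_measure _ _) Omega m).

Section integrands.
Context (R : realType) (n m : nat) (Omega : set 'rV[R]_n).
Implicit Type g : 'rV[R]_n -> 'rV[R]_m -> \bar R.
Local Notation mu := (lebesgueRn_measure R n).

Definition epigraph (f : 'rV[R]_m -> \bar R) : set ('rV[R]_m * R) :=
  [set za | (f za.1 <= za.2%:E)%E].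

Definition measurable_multifunction (Y : topologicalType)
    (S : 'rV[R]_n -> set Y) := forall O : set Y, open O ->
  measurable ([set x | Omega x /\ S x `&` O !=set0] : set (lebesgueRn R n)).

Definition normal_integrand g :=
  (forall x, Omega x -> closed (epigraph (g x))) /\
  measurable_multifunction (fun x => epigraph (g x)).

(* [g x] is only relevant for [x] in [Omega]. *)
Definition regular_integrand g := [/\ normal_integrand g,
  forall x, Omega x -> proper_ereal (g x) /\ convex_ereal (g x) &
  {ae mu, forall x, Omega x -> proto_differentiable (subdifferential (g x))}].

(* Convention of convex analysis: [+%dE] is the addition of extended reals with
   [+oo - oo = +oo], so the integral is [+oo] as soon as the integral of the
   positive part is. *)
Definition integral_functional g (u : L2Rn Omega m) : \bar R :=
  let f x : \bar R := g x (u x) in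
  ((\int[mu]_(x in Omega) f^\+ x)%E - (\int[mu]_(x in Omega) f^\- x)%E)%dE.

End integrands.

(* Main.v *)
(** A convex lower semicontinuous f on R^m has a resolvent P (its proximal map),
    and Minty's parametrization s |-> (P s, s - P s) turns the graph of its
    subdifferential into a Lipschitz copy of R^m.  A tangent (a, b) to the graph
    at (u, xi) is then a directional derivative: if the graph is geometrically
    derivable, (P (u + xi + t (a + b)) - u) / t tends to a as t decreases to 0.
    For an integrand g, the resolvents P_x give measurable selections without
    any selection theorem: P_x is the gradient of the Moreau envelope, which is
    measurable because its strict sublevel sets are tested by open subsets of
    the epigraph.

    xi belongs to the subdifferential of G at u iff it does pointwise almost
    everywhere; for the direct implication, test G at the function equal to
    P_x (u(x) + xi(x)) on a set of finite measure and to u elsewhere.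

    Graphical derivative.  Tangents in L^2 are pointwise tangents along an almost
    everywhere convergent subsequence.  Conversely the points
    P_x (u(x) + xi(x) + t (du(x) + dxi(x))) realize a field of pointwise tangents,
    and nonexpansiveness dominates their difference quotients.

    Coderivative.  A field of pointwise normals is normal in L^2 by dominated
    convergence.  Conversely, a normal in L^2 is polar to the tangent fields
    supported on sets of finite measure, hence almost everywhere polar to the
    tangent in each direction of a countable dense set, and in finite dimension
    this polarity gives regular normals by compactness of the unit ball. *)

From HB Require Import structures.
Require Import Defs.
From mathcomp Require Import all_boot all_order all_algebra.
From mathcomp Require Import all_classical all_reals all_analysis.
From mathcomp Require Import measurable_realfun ring lra.
Import Order.TTheory GRing.Theory Num.Theory.
Import numFieldNormedType.Exports.

Set Implicit Arguments.
Unset Strict Implicit.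
Unset Printing Implicit Defensive.

Local Open Scope classical_set_scope.
Local Open Scope ring_scope.

(** * Inner products and variational cones *)

Lemma cvgr0P (R : realType) (T : Type) {F : set_system T} {FF : Filter F} (f : T -> R) :
  f x @[x --> F] --> (0 : R) <->
  forall e, 0 < e -> \forall x \near F, `|f x| < e.
Proof.
split=> [f0 e e0|f0]; first exact: (@cvgr0_norm_lt R R^o T F FF f f0).
exact/(@cvgr0Pnorm_lt R R^o T F FF f).
Qed.

Section inner_product.
Context (R : realType) (V : innerProductType R).
Implicit Types (a : R) (u v w z : V).

Lemma innerDr u v w : inner u (v + w) = inner u v + inner u w.
Proof. by rewrite innerC innerDl !(innerC u). Qed.

Lemma innerZr a u v : inner u (a *: v) = a * inner u v.
Proof. by rewrite innerC innerZl innerC. Qed.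

Lemma innerNl u v : inner (- u) v = - inner u v.
Proof. by rewrite -scaleN1r innerZl mulN1r. Qed.

Lemma innerNr u v : inner u (- v) = - inner u v.
Proof. by rewrite innerC innerNl innerC. Qed.

Lemma innerBl u v w : inner (u - v) w = inner u w - inner v w.
Proof. by rewrite innerDl innerNl. Qed.

Lemma innerBr u v w : inner u (v - w) = inner u v - inner u w.
Proof. by rewrite innerDr innerNr. Qed.

Lemma inner0l u : inner 0 u = 0.
Proof. by rewrite -(scale0r u) innerZl mul0r. Qed.

Lemma inner0r u : inner u 0 = 0.
Proof. by rewrite innerC inner0l. Qed.

Lemma inner_sqB u v :
  inner (u - v) (u - v) = inner u u - 2 * inner u v + inner v v.
Proof. by rewrite innerBl !innerBr (innerC v u); ring. Qed.

Lemma hnorm_ge0 u : 0 <= hnorm u.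
Proof. exact: sqrtr_ge0. Qed.

Lemma sqr_hnorm u : hnorm u ^+ 2 = inner u u.
Proof. by rewrite sqr_sqrtr// inner_ge0. Qed.

Lemma hnorm0 : hnorm (0 : V) = 0.
Proof. by rewrite /hnorm inner0l sqrtr0. Qed.

Lemma hnorm_eq0 u : hnorm u = 0 -> u = 0.
Proof. by move=> u0; apply: inner_eq0; rewrite -sqr_hnorm u0 expr0n. Qed.

Lemma hnorm_gt0 u : u != 0 -> 0 < hnorm u.
Proof.
move=> u0; rewrite lt_neqAle hnorm_ge0 andbT eq_sym.
by apply: contra u0 => /eqP/hnorm_eq0/eqP.
Qed.

Lemma hnormZ a u : hnorm (a *: u) = `|a| * hnorm u.
Proof.
by rewrite /hnorm innerZl innerZr mulrA -expr2 sqrtrM ?sqr_ge0// sqrtr_sqr.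
Qed.

Lemma hnormN u : hnorm (- u) = hnorm u.
Proof. by rewrite -scaleN1r hnormZ normrN1 mul1r. Qed.

Lemma hnormBC u v : hnorm (u - v) = hnorm (v - u).
Proof. by rewrite -hnormN opprB. Qed.

Lemma cauchy_schwarz u v : inner u v <= hnorm u * hnorm v.
Proof.
have [->|v0] := eqVneq v 0; first by rewrite inner0r hnorm0 mulr0.
have [->|u0] := eqVneq u 0; first by rewrite inner0l hnorm0 mul0r.
have uv0 : 0 < 2 * (hnorm u * hnorm v) by rewrite !mulr_gt0 ?hnorm_gt0.
have := inner_ge0 ((hnorm v) *: u - (hnorm u) *: v).
rewrite inner_sqB !(innerZl, innerZr) -!sqr_hnorm => h.
by rewrite -subr_ge0 -(pmulr_rge0 _ uv0); lra.
Qed.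

Lemma cauchy_schwarz_norm u v : `|inner u v| <= hnorm u * hnorm v.
Proof.
rewrite ler_norml cauchy_schwarz andbT lerNl -innerNl -(hnormN u).
exact: cauchy_schwarz.
Qed.

Lemma hnormD u v : hnorm (u + v) <= hnorm u + hnorm v.
Proof.
rewrite -ler_sqr ?nnegrE ?hnorm_ge0 ?addr_ge0 ?hnorm_ge0// sqrrD !sqr_hnorm.
rewrite innerDl !innerDr (innerC v u); have := cauchy_schwarz u v.
by rewrite mulr2n; lra.
Qed.

Lemma hnormB u v : hnorm (u - v) <= hnorm u + hnorm v.
Proof. by rewrite -[leRHS]/(_ + hnorm v) -(hnormN v) hnormD. Qed.

(** Multiplying the quotient out removes the restriction $v \ne u$, because both sides vanish at $v
    = u$. All later arguments use this epsilon-delta form. *)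
Lemma regular_normal_coneP (U : set V) u z : regular_normal_cone U u z <->
  U u /\ forall e : R, 0 < e -> exists2 d : R, 0 < d &
    forall v, U v -> hnorm (v - u) < d -> inner z (v - u) <= e * hnorm (v - u).
Proof.
split=> [[Uu zle]|[Uu zle]]; split => //.
- move=> e e0.
  have [_ [d d0 <-] supe] : exists2 y, [set ereal_sup
      [set (inner z (u' - u) / hnorm (u' - u))%:E
        | u' in [set u' | U u' /\ 0 < hnorm (u' - u) < delta]]
    | delta in [set delta : R | 0 < delta]] y & (y < e%:E)%E.
    by apply: ereal_inf_lt; apply: le_lt_trans zle _; rewrite lte_fin.
  exists d => // v Uv vd.
  have [->|vu] := eqVneq (v - u) 0; first by rewrite inner0r hnorm0 mulr0.
  rewrite -ler_pdivrMr ?hnorm_gt0// -lee_fin; apply: le_trans (ltW supe).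
  by apply: ereal_sup_ubound; exists v => //; split => //; rewrite hnorm_gt0.
- apply/lee_addgt0Pr => e e0; rewrite add0e.
  have [d d0 zd] := zle _ e0.
  apply: (@le_trans _ _ (ereal_sup [set (inner z (u' - u) / hnorm (u' - u))%:E
        | u' in [set u' | U u' /\ 0 < hnorm (u' - u) < d]])).
    by apply: ereal_inf_lbound; exists d.
  apply: ge_ereal_sup => _ [v [Uv /andP[v0 vd]] <-].
  by rewrite lee_fin ler_pdivrMr//; exact: zd.
Qed.

Lemma hnorm_cvgP (T : Type) {F : set_system T} {FF : Filter F} (f : T -> V) u :
  hnorm (f x - u) @[x --> F] --> (0 : R) <->
  forall e, 0 < e -> \forall x \near F, hnorm (f x - u) < e.
Proof.
split=> [/cvgr0P fu e /fu|fu]; last apply/cvgr0P => e /fu.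
  by apply: filterS => x; rewrite ger0_norm// hnorm_ge0.
by apply: filterS => x; rewrite ger0_norm// hnorm_ge0.
Qed.

(** Regular normals are polar to tangents: write the normal inequality at the points [v i], divide
    by [tau i] and pass to the limit. *)
Lemma inner_normal_tangent_le0 (U : set V) u z w :
  regular_normal_cone U u z -> tangent_cone U u w -> inner z w <= 0.
Proof.
move=> /regular_normal_coneP[Uu zP] [_ [tau [v [tau0 tauc Uv vw]]]].
apply/ler_addgt0Pr => e e0; rewrite add0r.
(* Two errors must stay below [e]: $e'(\|w\|+1)$ from the normal inequality, since the quotient [q]
   has norm at most $\|w\|+1$, and $e'\|z\|$ from replacing [q] by [w]. *)
pose e' := e / (hnorm w + 2 + hnorm z).
have den0 : 0 < hnorm w + 2 + hnorm z.
  by have := hnorm_ge0 w; have := hnorm_ge0 z; lra.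
have e'0 : 0 < e' by rewrite divr_gt0.
have [d d0 zd] := zP _ e'0.
have d1 : 0 < d / (hnorm w + 1).
  by rewrite divr_gt0//; have := hnorm_ge0 w; lra.
have near_tau : \forall i \near \oo, `|tau i| < d / (hnorm w + 1).
  by move/cvgr0P : tauc; exact.
have near_v e1 : 0 < e1 -> \forall i \near \oo,
  hnorm ((tau i)^-1 *: (v i - u) - w) < e1 by move/hnorm_cvgP : vw; exact.
have /filter_ex[i [h1 [h2 h3]]] : \forall i \near \oo, `|tau i| < d / (hnorm w + 1) /\
    (hnorm ((tau i)^-1 *: (v i - u) - w) < e' /\
     hnorm ((tau i)^-1 *: (v i - u) - w) < 1).
  by apply: filterI => //; apply: filterI; apply: near_v.
set q := (tau i)^-1 *: (v i - u) in h2 h3.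
have t0 := tau0 i.
have vq : v i - u = tau i *: q by rewrite scalerA mulfV ?scale1r ?gt_eqF.
have qw : hnorm q <= hnorm w + 1.
  by rewrite -(subrK w q); apply: le_trans (hnormD _ _) _; lra.
have : inner z (v i - u) <= e' * hnorm (v i - u).
  apply: zd => //; rewrite vq hnormZ.
  rewrite ltr_pdivlMr in h1; last by have := hnorm_ge0 w; lra.
  apply: le_lt_trans h1; rewrite ler_wpM2l//.
rewrite vq innerZr hnormZ gtr0_norm// mulrCA ler_pM2l// => zq.
have -> : inner z w = inner z q - inner z (q - w) by rewrite innerBr; ring.
have := cauchy_schwarz_norm z (q - w); rewrite ler_norml => /andP[zqw _].
have zw : hnorm z * hnorm (q - w) <= hnorm z * e'.
  by rewrite ler_wpM2l ?hnorm_ge0 ?ltW.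
have eq_ : e' * hnorm q <= e' * (hnorm w + 1) by rewrite ler_wpM2l// ltW.
have : e' * (hnorm w + 2 + hnorm z) = e by rewrite mulfVK ?gt_eqF.
lra.
Qed.

End inner_product.

Section prod_norm.
Context (R : realType) (V W : innerProductType R).
Implicit Types (p q : V * W).

Lemma prod_innerE p q : inner p q = inner p.1 q.1 + inner p.2 q.2.
Proof. by []. Qed.

Lemma hnorm_fst_le p : hnorm p.1 <= hnorm p.
Proof.
rewrite -ler_sqr ?nnegrE ?hnorm_ge0// !sqr_hnorm prod_innerE lerDl.
exact: inner_ge0.
Qed.

Lemma hnorm_snd_le p : hnorm p.2 <= hnorm p.
Proof.
rewrite -ler_sqr ?nnegrE ?hnorm_ge0// !sqr_hnorm prod_innerE lerDr.
exact: inner_ge0.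
Qed.

Lemma hnorm_prod_le p : hnorm p <= hnorm p.1 + hnorm p.2.
Proof.
rewrite -ler_sqr ?nnegrE ?hnorm_ge0 ?addr_ge0 ?hnorm_ge0// sqrrD !sqr_hnorm.
rewrite prod_innerE; have : 0 <= hnorm p.1 * hnorm p.2 by rewrite mulr_ge0 ?hnorm_ge0.
by rewrite mulr2n; lra.
Qed.

End prod_norm.

(** * Euclidean topology *)

Section euclidean_topology.
Context (R : realType) (m : nat).
Implicit Types (u v w : 'rV[R]_m) (e : R).

Lemma rV_innerE u v : inner u v = \sum_(i < m) u 0 i * v 0 i.
Proof. by []. Qed.

Lemma ler_coord_hnorm v j : `|v 0 j| <= hnorm v.
Proof.
rewrite -ler_sqr ?nnegrE ?hnorm_ge0// sqr_hnorm real_normK ?num_real//.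
rewrite rV_innerE (bigD1 j)//= -expr2 lerDl.
by apply: sumr_ge0 => i _; rewrite -expr2 sqr_ge0.
Qed.

Lemma hnorm_le_coord v e : 0 <= e -> (forall j, `|v 0 j| <= e) ->
  hnorm v <= m%:R * e.
Proof.
move=> e0 ve; rewrite -ler_sqr ?nnegrE ?hnorm_ge0 ?mulr_ge0 ?ler0n//.
rewrite sqr_hnorm rV_innerE.
apply: (@le_trans _ _ (\sum_(i < m) e ^+ 2)).
  apply: ler_sum => i _; rewrite -expr2 -(real_normK (num_real (v 0 i))).
  by rewrite ler_sqr ?nnegrE.
rewrite sumr_const card_ord -[leLHS]mulr_natl exprMn ler_wpM2r ?sqr_ge0//.
by rewrite -natrX ler_nat; case: (m) => // k; rewrite expnS expn1 leq_pmulr.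
Qed.

(** The topology of ['rV[R]_m] is that of the maximum norm. This lemma and the next three translate
    between it and the Euclidean [hnorm]; squared norms, being polynomials, make continuity
    immediate. *)
Lemma continuous_inner_sqB u : continuous (fun v => inner (v - u) (v - u)).
Proof.
move=> v; rewrite (_ : (fun _ => _) = (fun v => \sum_(i < m) (v 0 i - u 0 i) ^+ 2)).
  apply: continuous_big v => [|i _ v]; first exact: add_continuous.
  have c : continuous (fun w : 'rV[R]_m => w 0 i - u 0 i).
    by move=> w; apply: continuousB; [exact: coord_continuous|exact: cst_continuous].
  have c2 : continuous (fun w : 'rV[R]_m => (w 0 i - u 0 i) * (w 0 i - u 0 i)).
    by move=> w; exact: (@continuousM R _ (fun w : 'rV[R]_m => w 0 i - u 0 i) (fun w : 'rV[R]_m => w 0 i - u 0 i) w (c w) (c w)).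
  by rewrite (_ : (fun _ => _) = (fun w : 'rV[R]_m => (w 0 i - u 0 i) * (w 0 i - u 0 i))).

apply/funext => w; rewrite rV_innerE.
by apply: eq_bigr => i _; rewrite !mxE expr2.
Qed.

Lemma nbhs_hnorm u e : 0 < e -> nbhs u [set v | hnorm (v - u) < e].
Proof.
move=> e0; have := @continuous_inner_sqB u u.
rewrite /continuous_at subrr inner0l => /cvgr0P/(_ (e ^+ 2)).
rewrite exprn_gt0// => /(_ isT); apply: filterS => v /=.
rewrite ger0_norm ?inner_ge0// -sqr_hnorm.
by rewrite ltr_pXn2r// nnegrE ?hnorm_ge0// ltW.
Qed.

Lemma nbhs_hnorm_sub u (B : set 'rV[R]_m) : nbhs u B ->
  exists2 e : R, 0 < e & forall v, hnorm (v - u) < e -> B v.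
Proof.
move=> /nbhs_ballP[e e0 eB]; exists e => // v vu; apply: eB; split => // i j.
rewrite ord1; apply: le_lt_trans vu; rewrite -normrN opprB.
by apply: le_trans (ler_coord_hnorm _ _); rewrite !mxE.
Qed.

Lemma closed_hnorm (C : set 'rV[R]_m) u : closed C ->
  (forall e : R, 0 < e -> exists2 v, C v & hnorm (v - u) < e) -> C u.
Proof.
move=> clC uC; apply: clC => B /nbhs_hnorm_sub[e e0 eB].
by have [v Cv vu] := uC _ e0; exists v; split => //; exact: eB.
Qed.

Lemma compact_hnorm_ball u r : compact [set v | hnorm (v - u) <= r].
Proof.
have [r0|r0] := leP 0 r; last first.
  suff -> : [set v | hnorm (v - u) <= r] = set0 by exact: compact0.
  apply/seteqP; split => // v /= vr.
  by have := hnorm_ge0 (v - u); lra.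
have clA : closed [set v | hnorm (v - u) <= r].
  rewrite (_ : mkset _ = (fun v => inner (v - u) (v - u)) @^-1` [set x | x <= r ^+ 2]).
    apply: closed_comp => [v _|]; last exact: closed_le.
    exact: continuous_inner_sqB.
  by apply/seteqP; split=> v /=; rewrite -sqr_hnorm ler_sqr ?nnegrE ?hnorm_ge0.
have coB : compact [set v : 'rV[R]_m | forall i, `[u 0 i - r, u 0 i + r]%classic (v 0 i)].
  apply: (@rV_compact R m (fun i => `[u 0 i - r, u 0 i + r]%classic)) => i.
  exact: segment_compact.
apply: subclosed_compact clA coB _ => v /= vr i; rewrite in_itv/= -ler_distl.
by apply: le_trans vr; apply: le_trans (ler_coord_hnorm _ i); rewrite !mxE.
Qed.

(** Bolzano-Weierstrass with a cluster point instead of an extracted subsequence: terms arbitrarily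
    far out come arbitrarily close to [b]. *)
Lemma bounded_cluster (a : nat -> 'rV[R]_m) M : (forall k, hnorm (a k) <= M) ->
  exists b, forall (e : R) j, 0 < e -> exists2 k, (j <= k)%N & hnorm (a k - b) < e.
Proof.
move=> aM; have [|b [_ clb]] := @compact_hnorm_ball 0 M (a @ \oo).
  by exists 0%N => // k _ /=; rewrite subr0.
exists b => e j e0.
have [_ [[k jk <-] abk]] : [set a k | k in [set k | (j <= k)%N]] `&` [set v | hnorm (v - b) < e] !=set0.
  apply: clb; last exact: nbhs_hnorm.
  by exists j => // k /= jk; exists k.
by exists k.
Qed.

Lemma exists_rat_near u e : 0 < e ->
  exists q : 'rV[rat]_m, forall j, `|u 0 j - ratr (q 0 j)| < e.
Proof.
move=> e0.
have /choice[q qP] : forall j, exists q : rat, `|u 0 j - ratr q| < e.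
  move=> j; have [|q qe] := @rat_in_itvoo R (u 0 j - e) (u 0 j + e); first by lra.
  by exists q; rewrite distrC ltr_distl; move: qe; rewrite in_itv.
by exists (\row_j q j) => j; rewrite mxE.
Qed.

Lemma rat_dense_hnorm u e : 0 < e ->
  exists q : 'rV[rat]_m, hnorm (u - map_mx ratr q) < e.
Proof.
(* The denominator absorbs the factor [m] of [hnorm_le_coord]; the added 1 keeps it positive when
   [m] is 0. *)
move=> e0; have [|q qP] := @exists_rat_near u (e / (m%:R + 1)).
  by rewrite divr_gt0// ltr_wpDl// ler0n.
exists q; apply: (@le_lt_trans _ _ (m%:R * (e / (m%:R + 1)))).
  apply: hnorm_le_coord => [|j].
    by rewrite divr_ge0 ?ltW// ltr_wpDl// ler0n.
  by rewrite !mxE ltW.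
rewrite mulrCA -[ltRHS]mulr1 ltr_pM2l// ltr_pdivrMr ?mul1r ?ltrDl//.
Qed.

End euclidean_topology.

(** * Proximal maps *)

(** This is the proximal objective as a function of a point and a height. It is minimized over the
    epigraph in [minty], and its strict sublevel sets are the open sets used in
    [measurable_moreau]. *)
Lemma continuous_add_half_inner (R : realType) (m : nat) (s : 'rV[R]_m) :
  continuous (fun p : 'rV[R]_m * R => p.2 + 2^-1 * inner (p.1 - s) (p.1 - s)).
Proof.
have csq : continuous (fun p : 'rV[R]_m * R => inner (p.1 - s) (p.1 - s)).
  move=> p; apply: (@continuous_comp _ _ _ (@fst 'rV[R]_m R) (fun v : 'rV[R]_m => inner (v - s) (v - s)) p).
    exact: cvg_fst.
  exact: continuous_inner_sqB.
move=> p; apply: continuousD; first exact: cvg_snd.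
by apply: (continuousM _ (csq p)); exact: cst_continuous.
Qed.

Lemma proper_fin (R : realType) (V : innerProductType R) (f : V -> \bar R) v :
  proper_ereal f -> (f v < +oo)%E -> exists a, f v = a%:E.
Proof. by move=> [/(_ v) + _]; case: (f v) => // a _ _; exists a. Qed.

Lemma subdifferential_fin (R : realType) (V : innerProductType R)
    (f : V -> \bar R) u xi :
  proper_ereal f -> subdifferential f u xi -> exists a, f u = a%:E.
Proof.
move=> propf uxi; apply: proper_fin => //; have [_ [v fv]] := propf.
have := le_lt_trans (uxi v) fv.
by case: (f u) => [r||]; rewrite ?ltry ?ltNyr ?addye.
Qed.

Section minty.
Context (R : realType) (m : nat) (f : 'rV[R]_m -> \bar R).
Hypotheses (clf : closed (epigraph f)) (propf : proper_ereal f)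
  (convf : convex_ereal f).
Implicit Types (s u v y z : 'rV[R]_m).

Let ftop v : (f v < +oo)%E -> exists a, f v = a%:E := proper_fin propf.

Lemma closed_sublevel a : closed [set z | (f z <= a%:E)%E].
Proof.
rewrite (_ : mkset _ = (fun z => (z, a)) @^-1` epigraph f)//.
apply: (@closed_comp _ _ (fun z : 'rV[R]_m => (z, a)) (epigraph f)) => // z _.
exact: (@cvg_pair _ _ _ (nbhs z) (nbhs z) (nbhs a) _ _ _ id (fun=> a) cvg_id (cvg_cst a)).
Qed.

(** Otherwise points of the ball with values below $-k$ for every $k$ would cluster at some [b];
    closed sublevel sets give $f(b) \le -k$ for all $k$, against properness. *)
Lemma bounded_below_ball z0 : exists2 M : R, 0 <= M &
  forall z, hnorm (z - z0) <= 1 -> ((- M)%:E <= f z)%E.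
Proof.
have [//|noM] := pselect (exists2 M : R, 0 <= M &
  forall z, hnorm (z - z0) <= 1 -> ((- M)%:E <= f z)%E).
have /choice[z zP] : forall k : nat, exists z,
    hnorm (z - z0) <= 1 /\ (f z < (- k%:R)%:E)%E.
  move=> k; apply: contrapT => nz; apply: noM; exists k%:R => // z z1.
  by rewrite leNgt; apply/negP => fz; apply: nz; exists z.
have [|b bP] := @bounded_cluster _ _ z (hnorm z0 + 1).
  move=> k; have := hnormD (z k - z0) z0; rewrite subrK.
  have := (zP k).1; lra.
have fb (k : nat) : (f b <= (- k%:R)%:E)%E.
  apply: (closed_hnorm (@closed_sublevel (- k%:R))) => e e0.
  have [j kj jb] := bP _ k e0; exists (z j) => //=.
  by apply: le_trans (ltW (zP j).2) _; rewrite lee_fin lerN2 ler_nat.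
have [a fa] : exists a, f b = a%:E by apply/ftop/(le_lt_trans (fb 0%N))/ltry.
have := fb (Num.truncn `|a|).+1; rewrite fa lee_fin lerNr.
have := truncnS_gt `|a|; have := ler_norm (- a); rewrite normrN; lra.
Qed.

(** Beyond the unit ball around [z0], the segment from [z0] to [z] crosses the unit sphere, where
    [f] is at least [- M]; convexity along the segment carries the bound out to [z] with linear
    growth. *)
Lemma affine_lower_bound z0 : (f z0 < +oo)%E ->
  exists2 C : R, 0 <= C & forall z, ((- C * (1 + hnorm (z - z0)))%:E <= f z)%E.
Proof.
move=> /ftop[b fz0]; have [M M0 fM] := bounded_below_ball z0.
exists (M + `|b|) => [|z]; first by rewrite addr_ge0.
have [z1|z1] := leP (hnorm (z - z0)) 1.
  apply: le_trans (fM _ z1); rewrite lee_fin mulNr lerN2.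
  have := hnorm_ge0 (z - z0); have := normr_ge0 b; nra.
have [fz|] := ltP (f z) +oo%E; last by apply: le_trans; rewrite leey.
have [a fa] := ftop fz; rewrite fa lee_fin.
set r := hnorm (z - z0) in z1 *; pose t := r^-1.
have r0 : 0 < r by lra.
have t01 : 0 < t < 1 by rewrite invr_gt0 r0/= invf_lt1.
have := convf z z0 t01; rewrite fa fz0.
have wE : t *: z + (1 - t) *: z0 - z0 = t *: (z - z0).
  by apply/rowP => i; rewrite !mxE; ring.
have := fM (t *: z + (1 - t) *: z0).
rewrite wE hnormZ gtr0_norm ?invr_gt0// mulVf ?gt_eqF// => /(_ (lexx _)).
move=> h1 h2; have := le_trans h1 h2.
rewrite -!EFinM -EFinD lee_fin => h.
have rt : r * t = 1 by rewrite mulfV// gt_eqF.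
have h3 : r * - M <= r * (t * a + (1 - t) * b) by rewrite ler_pM2l.
have h4 : r * (t * a + (1 - t) * b) = a + (r - 1) * b by rewrite mulrDr !mulrA rt mulrBr rt; ring.
have := ler_norm b; have := normr_ge0 b.
move: h3; rewrite h4; nra.
Qed.

(** The point [y] minimizes $f(y) + \|y-s\|^2/2$. As [f] is only lower semicontinuous, the minimum
    is taken of the continuous [F] over a compact piece of the epigraph; comparison along segments
    issuing from [y] then yields the subgradient inequality. *)
Lemma minty s : exists y, subdifferential f y (s - y).
Proof.
have [_ [z0 /[dup] fz0oo /ftop[b fz0]]] := propf.
have [C C0 fC] := affine_lower_bound fz0oo.
pose F (p : 'rV[R]_m * R) : R := p.2 + 2^-1 * inner (p.1 - s) (p.1 - s).
pose c0 := F (z0, b).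
pose D := hnorm (z0 - s).
pose A := `|c0| + C * (1 + D).
(* On [K] the distance $r$ to [s] satisfies $r^2/2 \le A + Cr$, that is $(r-C)^2 \le 2A + C^2$; then
   $x \le 1 + x^2$ with $x = r - C$ gives the bound. *)
pose B := C + 1 + 2 * A + C ^+ 2.
pose K := epigraph f `&` [set p | F p <= c0].
have A0 : 0 <= A by rewrite addr_ge0// mulr_ge0// addr_ge0// hnorm_ge0.
have KB p : K p -> hnorm (p.1 - s) <= B /\ - C * (1 + (B + D)) <= p.2 <= c0.
  move=> [pf pc]; have h : - C * (1 + hnorm (p.1 - z0)) <= p.2.
    by rewrite -lee_fin; apply: le_trans (fC _) pf.
  have tri : hnorm (p.1 - z0) <= hnorm (p.1 - s) + D.
    rewrite /D (hnormBC z0 s); apply: le_trans (hnormD _ _).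
    by rewrite addrA subrK.
  move: pc h; rewrite /= /F -sqr_hnorm; set r := hnorm (p.1 - s) in tri * => pc h.
  have r0 : 0 <= r := hnorm_ge0 _.
  have h' : - C * (1 + (r + D)) <= p.2.
    by apply: le_trans h; rewrite !mulNr lerN2 ler_wpM2l// lerD2l.
  have h2 : (r - C) ^+ 2 <= 2 * A + C ^+ 2.
    by have := ler_norm c0; rewrite /A; nra.
  have rB : r <= B.
    have B1 : r - C <= 1 + (2 * A + C ^+ 2).
      move: h2; move: (r - C) (2 * A + C ^+ 2) => x y; nra.
    by rewrite /B; lra.
  split => //; apply/andP; split; last by have := sqr_ge0 r; lra.
  by apply: le_trans h'; rewrite !mulNr lerN2 ler_wpM2l// lerD2l lerD2r.
have cF : continuous F by exact: continuous_add_half_inner.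
have clK : closed K.
  apply: closedI => //.
  apply: (@closed_comp _ _ F [set x | x <= c0]); last exact: closed_le.
  by move=> p _; exact: cF.
have coK : compact K.
  apply: subclosed_compact clK (compact_setX (@compact_hnorm_ball _ _ s B)
    (@segment_compact _ (- C * (1 + (B + D))) c0)) _.
  by move=> p /KB[p1 p2]; split => //=; rewrite in_itv.
have K0 : K (z0, b) by split => //=; rewrite /epigraph/= fz0.
have [[y a] /set_mem Kya ymin] :=
  compact_EVT_min (ex_intro _ _ K0) coK (continuous_subspaceT cF).
have [ya yc] := Kya; rewrite /epigraph/= in ya.
have Fmin p : epigraph f p -> F (y, a) <= F p.
  move=> pf; have [pc|pc] := leP (F p) c0.
    by apply: ymin; rewrite inE.
  exact: le_trans yc (ltW pc).
have [c fc] : exists c, f y = c%:E by apply/ftop/(le_lt_trans ya)/ltry.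
(* The minimizer lies on the graph of [f], for lowering the height decreases [F]. *)
have ca : c = a.
  apply/eqP; rewrite eq_le -!lee_fin -fc ya/= fc lee_fin.
  have := Fmin (y, c); rewrite /epigraph/= fc lexx => /(_ isT).
  by rewrite /F/= lerD2r.
exists y => v; rewrite fc.
have [/ftop[d fd]|] := ltP (f v) +oo%E; last by apply: le_trans; rewrite leey.
rewrite fd -EFinD lee_fin; apply/ler_addgt0Pr => e e0.
pose N := inner (v - y) (v - y).
have N0 : 0 <= N := inner_ge0 _.
(* The quadratic term is of order $t^2 N$; after division by [t] it must be at most [e]. *)
pose t := Num.min 2^-1 (e / (N + 1)).
have t0 : 0 < t by rewrite lt_min invr_gt0 ltr0n divr_gt0// ltr_wpDl.
have t1 : t < 1 by rewrite gt_min; apply/orP; left; rewrite invf_lt1// ltr1n.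
have tN : t * N <= e.
  have : t <= e / (N + 1) by rewrite ge_min lexx orbT.
  rewrite ler_pdivlMr ?ltr_wpDl//; nra.
have t01 : 0 < t < 1 by rewrite t0.
have := convf v y t01; rewrite fd fc -!EFinM -EFinD => fw.
have := Fmin (t *: v + (1 - t) *: y, t * d + (1 - t) * c) fw.
have -> : F (t *: v + (1 - t) *: y, t * d + (1 - t) * c) =
    t * d + (1 - t) * c + 2^-1 * (t ^+ 2 * N + (t *+ 2 * inner (v - y) (y - s) +
     inner (y - s) (y - s))).
  rewrite /F/=; congr (_ + _ * _); rewrite -inner_sqD.
  suff -> : t *: v + (1 - t) *: y - s = t *: (v - y) + (y - s) by [].
  by apply/rowP => i; rewrite !mxE; ring.
have -> : inner (s - y) (v - y) = - inner (v - y) (y - s).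
  by rewrite -(opprB y s) innerNl innerC.
rewrite /F/= -ca -[t *+ 2]mulr_natr.
move: (inner (v - y) (y - s)) (inner (y - s) (y - s)) => i1 i2 h.
have tN0 : 0 <= t ^+ 2 * N by rewrite mulr_ge0// sqr_ge0.
have : t * (c - i1) <= t * (d + t * N) by lra.
rewrite ler_pM2l//; lra.
Qed.

(** The resolvent $(I + \partial f)^{-1}$. The default 0 is returned only if no such point exists,
    which [minty] excludes. *)
Definition prox s : 'rV[R]_m := xget 0 [set y | subdifferential f y (s - y)].

Lemma prox_subdifferential s : subdifferential f (prox s) (s - prox s).
Proof. by have [y yP] := minty s; exact: (@xgetI _ 0 [set y | subdifferential f y (s - y)] y). Qed.

Lemma subdifferential_monotone u v xi eta : subdifferential f u xi ->
  subdifferential f v eta -> 0 <= inner (u - v) (xi - eta).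
Proof.
move=> uxi veta; have [a fa] := subdifferential_fin propf uxi.
have [b fb] := subdifferential_fin propf veta.
have := uxi v; have := veta u; rewrite fa fb -!EFinD !lee_fin.
have -> : inner xi (v - u) = - inner (u - v) xi by rewrite -(opprB u v) innerNr innerC.
rewrite [inner (u - v) (xi - eta)]innerBr (innerC eta); lra.
Qed.

(** Firm nonexpansiveness is monotonicity of the subdifferential at the two resolvent points; with
    Cauchy-Schwarz it gives the Lipschitz constant 1. *)
Lemma prox_firm s t :
  hnorm (prox s - prox t) ^+ 2 <= inner (prox s - prox t) (s - t).
Proof.
have := subdifferential_monotone (prox_subdifferential s) (prox_subdifferential t).
have -> : s - prox s - (t - prox t) = (s - t) - (prox s - prox t).
  by apply/rowP => i; rewrite !mxE; ring.
rewrite innerBr sqr_hnorm; lra.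
Qed.

Lemma prox_lipschitz s t : hnorm (prox s - prox t) <= hnorm (s - t).
Proof.
have [->|st] := eqVneq (prox s - prox t) 0; first by rewrite hnorm0 hnorm_ge0.
rewrite -(ler_pM2l (hnorm_gt0 st)) -expr2.
exact: le_trans (prox_firm _ _) (cauchy_schwarz _ _).
Qed.

(** Minty's parametrization of the graph by the sum [y + xi]. Two graph points with the same sum
    coincide: monotonicity gives $-\|y - y'\|^2 \ge 0$. *)
Lemma subdifferential_prox y xi : subdifferential f y xi <-> y = prox (y + xi).
Proof.
split=> [yxi|yE]; last first.
  by have := prox_subdifferential (y + xi); rewrite -yE addrAC subrr add0r.
have := subdifferential_monotone yxi (prox_subdifferential (y + xi)).
have -> : xi - (y + xi - prox (y + xi)) = - (y - prox (y + xi)).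
  by rewrite (addrC y) -addrA opprD addrA subrr add0r.
rewrite innerNr -sqr_hnorm oppr_ge0 => h.
by apply/subr0_eq/hnorm_eq0/eqP; rewrite -sqrf_eq0 eq_le h sqr_ge0.
Qed.

End minty.

(** * Directional derivatives of proximal maps *)

Lemma cvgr0_natSinv (R : realType) (f : nat -> R) C :
  (forall j, `|f j| <= C * j.+1%:R^-1) -> f @ \oo --> (0 : R).
Proof.
move=> fC; apply/cvgr0P => e e0.
have C0 : 0 < `|C| + 1 by rewrite ltr_wpDl.
have [N _ NP] := near_infty_natSinv_lt (PosNum (divr_gt0 e0 C0)).
exists N => // j /NP /=; rewrite ltr_pdivlMr// => je.
apply: le_lt_trans je; apply: le_trans (fC j) _; rewrite mulrC ler_wpM2l ?invr_ge0//.
by rewrite (le_trans (ler_norm _))// lerDl.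
Qed.

Lemma near0_rightP (R : realType) (Q : R -> Prop) :
  (\forall t \near 0^'+, Q t) <->
  exists2 d : R, 0 < d & forall t, 0 < t < d -> Q t.
Proof.
split=> [/nbhs_ballP[d d0 dQ]|[d d0 dQ]].
  exists d => // t /andP[t0 td]; apply: dQ => //=.
  by rewrite /ball/= sub0r normrN gtr0_norm.
apply/nbhs_ballP; exists d => //= t; rewrite /ball/= sub0r normrN => td t0.
by apply: dQ; rewrite t0/= (le_lt_trans (ler_norm _) td).
Qed.

Section prox_derivative.
Context (R : realType) (m : nat) (f : 'rV[R]_m -> \bar R).
Hypotheses (clf : closed (epigraph f)) (propf : proper_ereal f)
  (convf : convex_ereal f).
Local Notation S := (graph (subdifferential f)).
Local Notation prox := (prox f).
Implicit Types (u xi a b d z : 'rV[R]_m).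

(** A curve in the graph with velocity $(a,b)$ has Minty parameter $u + \xi + t(a+b) + o(t)$, and
    nonexpansiveness of [prox] carries the $o(t)$ over. The limit holds for all small $t$, whereas a
    tangent only supplies a sequence. *)
Lemma prox_curve_derivative u xi a b : geometrically_derivable S ->
  tangent_cone S (u, xi) (a, b) ->
  hnorm (t^-1 *: (prox (u + xi + t *: (a + b)) - u) - a) @[t --> 0^'+] --> (0 : R).
Proof.
move=> gS tS; have [Su _] := tS.
have [eps [c [eps0 cS c0 cd]]] := gS _ _ Su tS.
apply/hnorm_cvgP => e e0.
move/hnorm_cvgP : cd => /(_ (e / 3)); rewrite divr_gt0// => /(_ isT).
move=> /near0_rightP[d d0 dP]; apply/near0_rightP.
exists (Num.min d eps) => [|t]; first by rewrite lt_min d0.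
rewrite lt_min => /and3P[t0 td teps].
have := dP t; rewrite t0 td => /(_ isT); rewrite c0.
have : S (c t) by apply: cS; rewrite !ltW.
case: (c t) => y eta /= /(subdifferential_prox clf propf convf) yP.
set p := t^-1 *: _ - _ => pe.
have p1 := le_lt_trans (hnorm_fst_le p) pe.
have p2 := le_lt_trans (hnorm_snd_le p) pe.
have -> : t^-1 *: (prox (u + xi + t *: (a + b)) - u) - a =
    t^-1 *: (prox (u + xi + t *: (a + b)) - prox (y + eta)) + p.1.
  by rewrite /= -yP; apply/rowP => i; rewrite !mxE; ring.
apply: le_lt_trans (hnormD _ _) _.
have : hnorm (t^-1 *: (prox (u + xi + t *: (a + b)) - prox (y + eta))) <=
    hnorm p.1 + hnorm p.2.
  rewrite hnormZ; apply: le_trans (ler_wpM2l _ (prox_lipschitz clf propf convf _ _)) _.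
    exact: normr_ge0.
  rewrite -hnormZ; apply: le_trans (hnormD _ _); rewrite -(hnormN (p.1 + p.2)).
  suff -> : t^-1 *: (u + xi + t *: (a + b) - (y + eta)) = - (p.1 + p.2) by [].
  by apply/rowP => i; rewrite /= !mxE; field; rewrite gt_eqF.
lra.
Qed.

(** The difference quotients of [prox] in direction [d] are bounded by $\|d\|$, hence have a cluster
    point [a]. The two components of Minty's parametrization add up to the parameter, so the second
    component of the tangent is [d - a]. *)
Lemma tangent_exists u xi d : S (u, xi) ->
  exists a, tangent_cone S (u, xi) (a, d - a).
Proof.
move=> Su; have uP := (subdifferential_prox clf propf convf u xi).1 Su.
pose tau (k : nat) : R := k.+1%:R^-1.
have tau0 k : 0 < tau k by rewrite invr_gt0 ltr0n.
have [k|a aP] := @bounded_cluster _ _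
    (fun k => (tau k)^-1 *: (prox (u + xi + tau k *: d) - u)) (hnorm d).
  rewrite hnormZ gtr0_norm ?invr_gt0// {2}uP.
  rewrite ler_pdivrMl//; apply: le_trans (prox_lipschitz clf propf convf _ _) _.
  by rewrite addrAC subrr add0r hnormZ gtr0_norm.
have /choice[k kP] : forall j : nat, exists k, (j <= k)%N /\
    hnorm ((tau k)^-1 *: (prox (u + xi + tau k *: d) - u) - a) < j.+1%:R^-1.
  by move=> j; have [|k jk ka] := aP j.+1%:R^-1 j; [rewrite invr_gt0|exists k].
exists a; split => //; exists (tau \o k),
  (fun j => let y := prox (u + xi + tau (k j) *: d) in
    (y, u + xi + tau (k j) *: d - y)); split => //=.
- apply: (@cvgr0_natSinv _ _ 1) => j /=; rewrite mul1r gtr0_norm//.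
  by rewrite lef_pV2 ?posrE// ler_nat ltnS (kP j).1.
- by move=> j; exact: prox_subdifferential.
- apply: (@cvgr0_natSinv _ _ 2) => j /=; rewrite ger0_norm ?hnorm_ge0//.
  apply: le_trans (hnorm_prod_le _) _ => /=.
  have := (kP j).2; have t0 := tau0 (k j); set p := _ - a.
  have -> : (tau (k j))^-1 *: (u + xi + tau (k j) *: d -
    prox (u + xi + tau (k j) *: d) - xi) - (d - a) = - p.
    by apply/rowP => i; rewrite !mxE; field; rewrite gt_eqF.
  by rewrite hnormN mulr_natl mulr2n => /ltW pj; rewrite lerD.
Qed.

(** Graph points near $(u,\xi)$ have Minty parameter $u + \xi + tw$ with $\|w\| \le 1$. Their
    difference quotients are Lipschitz in $w$ uniformly in $t$, so polarity along rational
    directions spreads to neighbourhoods, and compactness of the unit ball makes the estimate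
    uniform. *)
Lemma polar_regular_normal u xi (z : 'rV[R]_m * 'rV[R]_m) : S (u, xi) ->
  (forall q : 'rV[rat]_m, let d := map_mx ratr q in exists2 a,
    hnorm (t^-1 *: (prox (u + xi + t *: d) - u) - a) @[t --> 0^'+] --> (0 : R) &
    inner z (a, d - a) <= 0) ->
  regular_normal_cone S (u, xi) z.
Proof.
move=> Su zP; have uP := (subdifferential_prox clf propf convf u xi).1 Su.
apply/regular_normal_coneP; split => // e e0.
(* Displacement from $(u,\xi)$ to the graph point with Minty parameter $u + \xi + tw$. *)
pose h t w := let y := prox (u + xi + t *: w) in (y - u, t *: w - (y - u)).
(* The error [E] below has components of norm at most $2e'$ and $3e'$. *)
pose B := 5 * hnorm z + 1.
have B0 : 0 < B by rewrite /B; have := hnorm_ge0 z; lra.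
pose e' := e / 2 / B.
have e'0 : 0 < e' by rewrite !divr_gt0.
(* Compactness in covering form: local bounds near each [w], valid for small [t], combine into one
   threshold on [t] for the whole ball. *)
have : \forall t \near 0^'+, [set w | hnorm (w - 0) <= 1] `<=` (fun w => inner z (h t w) <= e / 2 * t).
  apply: (compact_near_coveringP _).1 => [|w _]; first exact: compact_hnorm_ball.
  have [q qw] := rat_dense_hnorm w e'0.
  have [a aP za] := zP q.
  exists ([set w' | hnorm (w' - map_mx ratr q) < e'],
      [set t | 0 < t /\
        hnorm (t^-1 *: (prox (u + xi + t *: map_mx ratr q) - u) - a) < e']).
    split => /=.
      have wq : 0 < e' - hnorm (w - map_mx ratr q) by rewrite subr_gt0.
      apply: filterS (nbhs_hnorm w wq) => w' /= w'w.
      have := hnormD (w' - w) (w - map_mx ratr q).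
      by rewrite addrA subrK; lra.
    move/hnorm_cvgP : aP => /(_ _ e'0) /near0_rightP[d d0 dP].
    by apply/near0_rightP; exists d => // t /[dup] /dP tP /andP[].
  move=> [w' t] /= [w'q [t0 ta]].
  pose E : 'rV[R]_m * 'rV[R]_m := t^-1 *: h t w' - (a, map_mx ratr q - a).
  have E1E : E.1 = t^-1 *: (prox (u + xi + t *: w') - u) - a by [].
  have E2E : E.2 = t^-1 *: (t *: w' - (prox (u + xi + t *: w') - u)) -
    (map_mx ratr q - a) by [].
  have -> : h t w' = t *: ((a, map_mx ratr q - a) + E).
    by rewrite addrC subrK scalerA mulfV ?scale1r// gt_eqF.
  clearbody E.
  have E1 : hnorm E.1 <= 2 * e'.
    have -> : E.1 = t^-1 *: (prox (u + xi + t *: w') - prox (u + xi + t *: map_mx ratr q)) +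
        (t^-1 *: (prox (u + xi + t *: map_mx ratr q) - u) - a).
      by rewrite E1E; apply/rowP => i; rewrite !mxE; ring.
    have := prox_lipschitz clf propf convf (u + xi + t *: w') (u + xi + t *: map_mx ratr q).
    have -> : u + xi + t *: w' - (u + xi + t *: map_mx ratr q) = t *: (w' - map_mx ratr q).
      by apply/rowP => i; rewrite !mxE; ring.
    rewrite hnormZ gtr0_norm// -ler_pdivrMl//.
    have := hnormD (t^-1 *: (prox (u + xi + t *: w') - prox (u + xi + t *: map_mx ratr q)))
      (t^-1 *: (prox (u + xi + t *: map_mx ratr q) - u) - a).
    by rewrite [hnorm (t^-1 *: (prox _ - prox _))]hnormZ gtr0_norm ?invr_gt0//; lra.
  have E2 : hnorm E.2 <= 3 * e'.
    have -> : E.2 = (w' - map_mx ratr q) - E.1.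
      by rewrite E1E E2E; apply/rowP => i; rewrite !mxE; field; rewrite gt_eqF.
    by have := hnormB (w' - map_mx ratr q) E.1; lra.
  rewrite innerZr innerDr [leRHS]mulrC ler_pM2l//.
  have : inner z E <= hnorm z * (5 * e').
    apply: le_trans (cauchy_schwarz _ _) _; rewrite ler_wpM2l ?hnorm_ge0//.
    by apply: le_trans (hnorm_prod_le _) _; lra.
  have : e' * B = e / 2 by rewrite /e' mulfVK ?gt_eqF.
  by rewrite /B; lra.
move=> /near0_rightP[d d0 dP].
(* The parameter length [t] is at most twice the norm of the displacement [k]; the same factor 2
   explains the constant $e/2$ above. *)
exists (d / 2) => [|[y eta] yS]; first by rewrite divr_gt0.
have yP := (subdifferential_prox clf propf convf y eta).1 yS.
set k := (y, eta) - (u, xi) => kd.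
pose t := hnorm (y + eta - (u + xi)).
have tk : t <= 2 * hnorm k.
  have := hnormD k.1 k.2; have := hnorm_fst_le k; have := hnorm_snd_le k.
  rewrite [X in hnorm X <= _ + _](_ : _ = y + eta - (u + xi)) ?/t; first lra.
  by apply/rowP => i; rewrite !mxE; ring.
have [t0|t0] := eqVneq t 0.
  have ye : y + eta = u + xi by apply/subr0_eq/hnorm_eq0.
  have yu : y = u by rewrite yP ye -uP.
  have -> : k = 0.
    rewrite /k yu; move: ye; rewrite yu => /addrI ->.
    by rewrite subrr.
  by rewrite inner0r hnorm0 mulr0.
have {}t0 : 0 < t by rewrite lt_neqAle eq_sym t0 hnorm_ge0.
pose w := t^-1 *: (y + eta - (u + xi)).
have tw : t *: w = y + eta - (u + xi) by rewrite scalerA mulfV ?scale1r ?gt_eqF.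
have := dP t _ w; rewrite t0 /= subr0 hnormZ gtr0_norm ?invr_gt0// mulVf ?gt_eqF//.
have -> : h t w = k.
  rewrite /h tw [u + xi + _]addrC subrK -yP; congr (_, _).
  by apply/rowP => i; rewrite !mxE; ring.
have td : t < d by lra.
move=> /(_ td (lexx _)) /le_trans; apply.
by rewrite -mulrA ler_pM2l//; lra.
Qed.

End prox_derivative.

(** * Measurability of proximal maps *)

Section moreau_envelope.
Context (R : realType) (m : nat) (f : 'rV[R]_m -> \bar R).
Hypotheses (clf : closed (epigraph f)) (propf : proper_ereal f)
  (convf : convex_ereal f).
Implicit Types (s h z : 'rV[R]_m).
Local Notation prox := (prox f).

(** The Moreau envelope, written as the value at the minimizer; [moreau_le] shows that it is the
    infimum. *)
Definition moreau s : R :=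
  fine (f (prox s)) + 2^-1 * inner (prox s - s) (prox s - s).

Let fproxE s : f (prox s) = (fine (f (prox s)))%:E.
Proof.
have [a fa] := subdifferential_fin propf (prox_subdifferential clf propf convf s).
by rewrite fa.
Qed.

Lemma moreau_le s z (a : R) : (f z <= a%:E)%E ->
  moreau s <= a + 2^-1 * inner (z - s) (z - s).
Proof.
move=> fz; have := le_trans (prox_subdifferential clf propf convf s z) fz.
rewrite fproxE -EFinD lee_fin /moreau.
have -> : z - s = (z - prox s) + (prox s - s) by rewrite addrA subrK.
have := inner_ge0 (z - prox s).
rewrite -[z - prox s + _]/(_) -[in X in _ -> _ -> _ <= _ + _ * X](scale1r (z - prox s)) inner_sqD.
rewrite -(opprB (prox s) s) innerNl (innerC (prox s - s)).
lra.
Qed.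

(** The upper estimate tests the envelope at [s + h] with the old proximal point. The lower one is
    the same estimate from [s + h] back to [s], combined with nonexpansiveness of [prox]. *)
Lemma moreau_gradient s h :
  `|moreau (s + h) - moreau s - inner h (s - prox s)| <= 2^-1 * inner h h.
Proof.
have up s' h' : moreau (s' + h') <= moreau s' + inner h' (s' - prox s') + 2^-1 * inner h' h'.
  apply: le_trans (@moreau_le (s' + h') (prox s') (fine (f (prox s'))) _) _.
    by rewrite -fproxE.
  rewrite /moreau (_ : prox s' - (s' + h') = -1 *: h' + (prox s' - s')); last first.
    by apply/rowP => i; rewrite !mxE; ring.
  by rewrite inner_sqD -(opprB s' (prox s')) innerNr; lra.
have := up s h; have := up (s + h) (- h).
rewrite addrK !innerNl innerNr opprK.
have -> : s + h - prox (s + h) = (s - prox s) + h - (prox (s + h) - prox s).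
  by apply/rowP => i; rewrite !mxE; ring.
rewrite innerBr innerDr.
have := cauchy_schwarz h (prox (s + h) - prox s).
have := prox_lipschitz clf propf convf (s + h) s.
rewrite [s + h - s]addrAC subrr add0r => p1 p2.
have p3 : inner h (prox (s + h) - prox s) <= inner h h.
  apply: le_trans p2 _; rewrite -sqr_hnorm expr2 ler_wpM2l//.
  exact: hnorm_ge0.
by rewrite ler_norml => h1 h2; apply/andP; split; lra.
Qed.

End moreau_envelope.

Section measurable_prox.
Context (R : realType) (n m : nat) (Omega : set 'rV[R]_n).
Context (g : 'rV[R]_n -> 'rV[R]_m -> \bar R).
Hypotheses (ng : normal_integrand Omega g)
  (gpc : forall x, Omega x -> proper_ereal (g x) /\ convex_ereal (g x)).
Local Notation T := (lebesgueRn R n).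
Local Notation D := (Omega : set T).

Let clg x : Omega x -> closed (epigraph (g x)).
Proof. by case: ng => + _; apply. Qed.

Let prg x : Omega x -> proper_ereal (g x).
Proof. by move=> /gpc[]. Qed.

Let cvg_ x : Omega x -> convex_ereal (g x).
Proof. by move=> /gpc[]. Qed.

(** Epigraphs are nonempty by properness, so testing the epigraphical mapping with the full space
    returns [Omega]. *)
Lemma integrand_domain_measurable : measurable D.
Proof.
have := ng.2 _ openT; congr measurable.
apply/seteqP; split=> [x []//|x Ox]; split => //.
have [gN [v gv]] := prg Ox; exists (v, fine (g x v)); split => //.
by rewrite /epigraph/=; case: (g x v) (gN v) gv.
Qed.
Let mD := integrand_domain_measurable.

Lemma measurable_moreau s : measurable_fun D (fun x => moreau (g x) s).
Proof.
apply: (measurability _ (RGenInftyO.measurableE R)) => //.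
move=> _ [_ [c ->] <-].
pose O : set ('rV[R]_m * R) :=
  (fun p => p.2 + 2^-1 * inner (p.1 - s) (p.1 - s)) @^-1` [set y | y < c].
have oO : open O.
  apply: open_comp; last exact: open_lt.
  by move=> p _; exact: continuous_add_half_inner.
have := ng.2 _ oO; congr measurable; apply/seteqP; split => x /=.
  move=> [Ox [[z a] /= [za zc]]]; split => //; rewrite in_itv/=.
  exact: le_lt_trans (moreau_le (clg Ox) (prg Ox) (cvg_ Ox) s za) zc.
move=> [Ox]; rewrite in_itv/= => xc; split => //.
exists (prox (g x) s, fine (g x (prox (g x) s))); split => //.
have [a fa] := subdifferential_fin (prg Ox)
  (prox_subdifferential (clg Ox) (prg Ox) (cvg_ Ox) s).
by rewrite /epigraph/= fa.
Qed.

(** Coordinate [j] of $s - P_x s$ is a partial derivative of the envelope, hence a pointwise limit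
    of measurable difference quotients; with step $1/(k+1)$ the error is at most $1/(2(k+1))$. *)
Lemma measurable_prox_cst s j : measurable_fun D (fun x => prox (g x) s 0 j).
Proof.
pose dj (k : nat) : 'rV[R]_m := k.+1%:R^-1 *: delta_mx 0 j.
apply: (@measurable_fun_cvg _ _ _ D (fun k x => s 0 j -
  k.+1%:R * (moreau (g x) (s + dj k) - moreau (g x) s))).
  move=> k; apply: (measurable_funB (measurable_cst _)).
  apply: (measurable_funM (measurable_cst _)).
  exact: (measurable_funB (measurable_moreau _) (measurable_moreau _)).
move=> x Ox.
apply/subr_cvg0/(@cvgr0_natSinv _ _ 2^-1) => k.
have := moreau_gradient (clg Ox) (prg Ox) (cvg_ Ox) s (dj k).
have innerdj v : inner (dj k) v = k.+1%:R^-1 * v 0 j.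
  rewrite innerZl rV_innerE (bigD1 j)//= big1 => [|i ij]; rewrite !mxE ?eqxx.
    by rewrite mul1r addr0.
  by rewrite (negPf ij) mul0r.
rewrite !innerdj !mxE !eqxx/= mulr1.
have k0 : 0 < k.+1%:R :> R by rewrite ltr0n.
move: (moreau _ _) (moreau _ _) => a b.
rewrite -(ler_pM2l k0) -{1}(gtr0_norm k0) -normrM -[X in `|X|]opprK normrN.
rewrite [X in _ <= X -> _](_ : _ = 2^-1 * k.+1%:R^-1); last first.
  by field; rewrite gt_eqF.
apply: le_trans; rewrite le_eqVlt; apply/orP; left; apply/eqP; congr (`| _ |).
by field; rewrite gt_eqF.
Qed.

Section rational_boxes.
Variable s : T -> 'rV[R]_m.
Hypothesis ms : forall j, measurable_fun setT (fun x => s x 0 j).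

Let near_box (q : 'rV[rat]_m) (k : nat) : set T :=
  [set x | forall i, `|s x 0 i - ratr (q 0 i)| < k.+1%:R^-1].

Let m_near_box q k : measurable (near_box q k).
Proof.
rewrite (_ : near_box q k = \bigcap_(i in [set: 'I_m])
    ((fun x => `|s x 0 i - ratr (q 0 i)|) @^-1` [set y | y < k.+1%:R^-1])).
  apply: fin_bigcap_measurable => // i _; rewrite -[_ @^-1` _]setTI.
  have mN : measurable_fun setT (fun x => `|s x 0 i - ratr (q 0 i)|).
    apply: (measurableT_comp (@normr_measurable R setT)).
    exact: (measurable_funB (ms i) (measurable_cst _)).
  by apply: mN => //; rewrite -set_itvNyo.
by apply/seteqP; split=> x /= xk i; [move=> _|]; exact: xk.
Qed.

Let near_box_ex x k : exists q, near_box q k x.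
Proof. by have [|q qP] := @exists_rat_near R m (s x) k.+1%:R^-1; [|exists q]. Qed.

Let slack_lt (c y k P1 P2 : R) : 0 <= y -> y * (2 * k + 1) < c - P1 ->
  `|P1 - P2| <= k * y -> P2 < c - k * y.
Proof. by move=> y0 yc /ler_normlP[? ?]; lra. Qed.

(** Carathéodory argument: $P_x s$ is measurable in $x$ and Lipschitz in $s$, so $s(x)$ may be
    replaced by a rational vector within $1/(k+1)$ in each coordinate, at a cost of $m/(k+1)$. *)
Lemma measurable_prox j : measurable_fun D (fun x => prox (g x) (s x) 0 j).
Proof.
apply: (measurability _ (RGenInftyO.measurableE R)) => //.
move=> _ [_ [c ->] <-].
rewrite (_ : _ `&` _ = \bigcup_(p : 'rV[rat]_m * nat) (near_box p.1 p.2 `&` (D `&`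
  ((fun x => prox (g x) (map_mx ratr p.1) 0 j) @^-1`
     [set y | y < c - m%:R * p.2.+1%:R^-1])))).
  apply: countable_bigcupT_measurable => [|[q k]]; first exact: countableP.
  apply: measurableI => //=.
  by rewrite -set_itvNyo; exact: measurable_prox_cst.
have close x q k : Omega x -> near_box q k x ->
    `|prox (g x) (s x) 0 j - prox (g x) (map_mx ratr q) 0 j| <= m%:R * k.+1%:R^-1.
  move=> Ox qk; apply: (@le_trans _ _ (hnorm (s x - map_mx ratr q))).
    apply: le_trans (prox_lipschitz (clg Ox) (prg Ox) (cvg_ Ox) _ _).
    by apply: le_trans (ler_coord_hnorm _ j); rewrite !mxE.
  by apply: hnorm_le_coord => // i; rewrite !mxE ltW//; exact: qk.
apply/seteqP; split => x /=.
  move=> [Ox]; rewrite in_itv/= => xc.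
  pose d := c - prox (g x) (s x) 0 j.
  have d0 : 0 < d by rewrite subr_gt0.
  (* The cost is paid twice, once in passing to [q] and once in the strengthened inequality; the
     added 1 covers [m] equal to 0. *)
  have m0 : 0 < 2 * m%:R + 1 :> R by rewrite ltr_wpDl// mulr_ge0.
  have [N _ NP] := near_infty_natSinv_lt (PosNum (divr_gt0 d0 m0)).
  have [q qP] := near_box_ex x N.
  exists (q, N) => //=; split => //; split => //.
  have := NP N (leqnn N); rewrite /= ltr_pdivlMr// => yd.
  have yq := close _ _ _ Ox qP.
  have y0 : 0 <= N.+1%:R^-1 :> R by [].
  exact: slack_lt y0 yd yq.
move=> [[q k] _ /= [qk [Ox xc]]]; split => //; rewrite in_itv/=.
have /ler_normlP[_ qx] := close _ _ _ Ox qk.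
have := lerD qx (lexx (prox (g x) (map_mx ratr q) 0 j)); rewrite subrK.
by move/le_lt_trans; apply; rewrite -ltrBrDl.
Qed.

(** By closedness, $g(x,s(x)) \le c$ means that $(s(x),c)$ is a limit of epigraph points. This is
    tested by countably many balls centred at rational vectors near $s(x)$, at height $c$. *)
Lemma measurable_integrand : measurable_fun D (fun x => g x (s x)).
Proof.
apply: (measurability _ (ErealGenOInfty.measurableE R)) => //.
move=> _ [_ [c ->] <-].
pose O (q : 'rV[rat]_m) k : set ('rV[R]_m * R) :=
  ball (map_mx ratr q : 'rV[R]_m, c) k.+1%:R^-1.
have OP q k z a : O q k (z, a) <->
    (forall i, `|z 0 i - ratr (q 0 i)| < k.+1%:R^-1) /\ `|a - c| < k.+1%:R^-1.
  split=> [[[_ qz] ca]|[qz ca]]; split.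
  - by move=> i; have := qz 0 i; rewrite /ball/= mxE distrC.
  - by rewrite distrC.
  - by split => // i j; rewrite ord1 /ball/= mxE distrC; exact: qz.
  - by rewrite /ball/= distrC.
have oO q k : open (O q k) by exact: ball_open.
rewrite (_ : _ `&` _ = D `\` \bigcap_k \bigcup_(q : 'rV[rat]_m)
   (near_box q k `&` [set x | Omega x /\ epigraph (g x) `&` O q k !=set0])).
  apply: measurableD => //; apply: bigcapT_measurable => k.
  apply: countable_bigcupT_measurable => [|q]; first exact: countableP.
  by apply: measurableI => //; exact: ng.2.
apply/seteqP; split => x /= [Ox].
  rewrite in_itv/= andbT => cg; split => // xO.
  suff : (g x (s x) <= c%:E)%E by rewrite leNgt cg.
  suff : closure (epigraph (g x)) (s x, c) by exact: (clg Ox).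
  move=> B /nbhs_ballP[e e0 eB].
  have [N _ NP] := near_infty_natSinv_lt (PosNum (divr_gt0 e0 (ltr0n R 2))).
  have /= Ne := NP N (leqnn N).
  have [q _ [qx [_ [[z a] [za /OP[qz ac]]]]]] := xO N I.
  exists (z, a); split => //; apply: eB; split; last first.
    rewrite /ball/= distrC; apply: lt_trans ac _; apply: lt_trans Ne _.
    by rewrite ltr_pdivrMr// ltr_pMr// ltr1n.
  split => // i j; rewrite ord1 /ball/=.
  apply: le_lt_trans (ler_distD (ratr (q 0 j)) _ _) _.
  have h1 := lt_trans (qx j) Ne; have h2 := lt_trans (qz j) Ne.
  by rewrite (splitr e) ltrD// distrC.
move=> nO; split => //; rewrite in_itv/= andbT ltNge; apply/negP => gc.
apply: nO => k _; have [q qP] := near_box_ex x k; exists q => //.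
split => //; split => //; exists (s x, c); split => //.
by apply/OP; split => //; rewrite subrr normr0.
Qed.

End rational_boxes.
End measurable_prox.

(** * Lebesgue measure of cubes *)

(** The map [e] may identify indices. A section [s] of [e] reindexes the sum over the image by a
    subset of [P], and the remaining terms are nonnegative. *)
Lemma le_esum_image (R : realType) (T T' : choiceType) (x0 : T) (P : set T)
    (e : T -> T') (a : T' -> \bar R) :
  (forall i, P i -> (0 <= a (e i))%E) ->
  (\esum_(j in e @` P) a j <= \esum_(i in P) a (e i))%E.
Proof.
move=> a0.
have /choice[s sP] : forall j, exists i, (e @` P) j -> P i /\ e i = j.
  move=> j; have [[i Pi <-]|nj] := pselect ((e @` P) j); first by exists i.
  by exists x0.
have -> : \esum_(j in e @` P) a j = \esum_(j in e @` P) a (e (s j)).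
  by apply: eq_esum => j /sP[_ ->].
rewrite -(@esum_image R _ _ (e @` P) s (a \o e)); last first.
  move=> j k /set_mem /sP[_ ej] /set_mem /sP[_ ek] jk.
  by rewrite -ej -ek jk.
rewrite [leRHS](@esumID _ _ (s @` (e @` P)))//.
rewrite setIidr; last by move=> _ [j /sP[Ps _] <-].
by rewrite leeDl// esum_ge0// => i [/a0].
Qed.

Section lebesgue_boxes.
Context (R : realType) (n : nat).
Local Notation T := (lebesgueRn R n).
Local Notation box_ends := ('rV[R]_n * 'rV[R]_n)%type.
Local Notation mu := (lebesgueRn_measure R n).
Implicit Types (ab : box_ends).

Let le_ends ab := forall i, ab.1 0 i <= ab.2 0 i.

Section split.
Variables (i : 'I_n) (c : R).

Let cut ab := Num.max (ab.1 0 i) (Num.min (ab.2 0 i) c).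
Let upd (v : 'rV[R]_n) x : 'rV[R]_n := \row_j if j == i then x else v 0 j.
Let left ab : box_ends := (ab.1, upd ab.2 (cut ab)).
Let right ab : box_ends := (upd ab.1 (cut ab), ab.2).

Let cut_le ab : le_ends ab -> ab.1 0 i <= cut ab <= ab.2 0 i.
Proof. by move=> h; rewrite le_max lexx/= ge_max h ge_min lexx. Qed.

Let left_le ab : le_ends ab -> le_ends (left ab).
Proof.
move=> h j; rewrite /= mxE; case: eqP => [->|//].
by have /andP[] := cut_le h.
Qed.

Let right_le ab : le_ends ab -> le_ends (right ab).
Proof.
move=> h j; rewrite /= mxE; case: eqP => [->|//].
by have /andP[] := cut_le h.
Qed.

Let vol_split ab : (box_vol (left ab) + box_vol (right ab) = box_vol ab)%E.
Proof.
rewrite /box_vol -EFinD; congr EFin.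
rewrite (bigD1 i)//= [X in _ + X = _](bigD1 i)//= [RHS](bigD1 i)//= !mxE eqxx.
rewrite (eq_bigr (fun j => ab.2 0 j - ab.1 0 j)); last first.
  by move=> j /negPf ji; rewrite !mxE ji.
rewrite [X in _ + _ * X = _](eq_bigr (fun j => ab.2 0 j - ab.1 0 j)); last first.
  by move=> j /negPf ji; rewrite !mxE ji.
by rewrite -mulrDl; congr (_ * _); rewrite addrC addrA subrK.
Qed.

(* Both halves of a cover are cut at the same coordinate, clamped to each box, so
   that no box becomes invalid and volumes add up. *)
Lemma lebesgue_half_space_measurable : measurable ([set x | x 0 i <= c] : set T).
Proof.
apply: le_caratheodory_measurable => X.
apply: le_ereal_inf_tmp => _ [C [cC Cle XC] <-].
have h (e : box_ends -> box_ends) Y : (forall ab, le_ends ab -> le_ends (e ab)) ->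
    Y `<=` \bigcup_(ab in C) box (e ab) ->
    (lebesgue_outer Y <= \esum_(ab in C) box_vol (e ab))%E.
  move=> ele YC; apply: le_trans (le_esum_image (0, 0) _); last first.
    by move=> ab /Cle/ele; exact: box_vol_ge0.
  apply: ereal_inf_lbound; exists (e @` C) => //; split.
  - exact: (card_le_trans (card_image_le _ _) cC).
  - by move=> _ [ab /Cle/ele eab <-].
  - by move=> x /YC[ab Cab abx]; exists (e ab) => //; exists ab.
under eq_esum do rewrite -vol_split.
rewrite esumD; last 2 first.
- by move=> ab /Cle/left_le; exact: box_vol_ge0.
- by move=> ab /Cle/right_le; exact: box_vol_ge0.
apply: leeD; apply: h => //.
- move=> x [/XC[ab Cab abx] /= xc]; exists ab => // j; rewrite /= mxE.
  have /andP[a1 a2] := abx j; rewrite a1/=; case: eqP => // jE.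
  by rewrite /cut le_max le_min -jE a2 jE xc orbT.
- move=> x [/XC[ab Cab abx] /= /negP]; rewrite -ltNge => xc; exists ab => // j.
  rewrite /= mxE; have /andP[a1 a2] := abx j; rewrite a2 andbT.
  by case: eqP => // jE; rewrite /cut ge_max ge_min -jE a1/= jE (ltW xc) orbT.
Qed.

End split.

(** An increasing exhaustion by sets of finite measure. Half-open cubes are finite intersections of
    half spaces $x_i \le c$ and complements of such. *)
Definition halfopen_cube (k : nat) : set T :=
  [set x | forall i, - k%:R < x 0 i <= k%:R].

Lemma measurable_halfopen_cube k : measurable (halfopen_cube k).
Proof.
rewrite (_ : halfopen_cube k = \bigcap_(i in [set: 'I_n])
    ([set x : T | x 0 i <= k%:R] `&` ~` [set x : T | x 0 i <= - k%:R])).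
  apply: fin_bigcap_measurable => // i _; apply: measurableI.
    exact: lebesgue_half_space_measurable.
  by apply: measurableC; exact: lebesgue_half_space_measurable.
apply/seteqP; split=> x /= xk i; [move=> _|];
  have /= := xk i; rewrite ltNge.
  by move=> /andP[/negP].
by move=> /(_ I)[-> /negP ->].
Qed.

Lemma halfopen_cube_lty k : (mu (halfopen_cube k) < +oo)%E.
Proof.
pose ab : box_ends := (const_mx (- k%:R), const_mx k%:R).
have abh : le_ends ab by move=> i; rewrite !mxE -subr_ge0 opprK addr_ge0.
apply: (@le_lt_trans _ _ (box_vol ab)); last exact: ltry.
rewrite -(@esum_set1 _ _ ab (@box_vol R n)) ?box_vol_ge0//.
apply: ereal_inf_lbound; exists [set ab] => //; split => //.
- by move=> _ ->.
- by move=> x xk; exists ab => // i; rewrite !mxE; have /andP[/ltW -> ->] := xk i.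
Qed.

Lemma bigcup_halfopen_cube : \bigcup_k halfopen_cube k = setT.
Proof.
apply/seteqP; split => // x _; exists (Num.truncn (hnorm (x : 'rV[R]_n))).+1 => // i.
have := ler_coord_hnorm (x : 'rV[R]_n) i; rewrite ler_norml => /andP[].
have := truncnS_gt (hnorm (x : 'rV[R]_n)); lra.
Qed.

Lemma halfopen_cubeS j k : (j <= k)%N -> halfopen_cube j `<=` halfopen_cube k.
Proof.
move=> jk x xj i; have /andP[h1 h2] := xj i.
rewrite (le_trans h2) ?ler_nat// andbT; apply: le_lt_trans h1.
by rewrite lerN2 ler_nat.
Qed.

End lebesgue_boxes.

(** * The space L2 *)

Section L2_tools.
Context d (T : measurableType d) (R : realType).
Variables (mu : {measure set T -> \bar R}) (D : set T) (m : nat).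
Local Notation L2 := (L2 mu D m).
Implicit Types (u v : L2) (f h : T -> 'rV[R]_m).

Local Notation measurable_coord f := (forall j, measurable_fun setT (fun x => f x 0 j)).

Lemma L2_square_integrable u : square_integrable mu D u.
Proof. exact: sqfunP. Qed.

Lemma measurable_L2 u j : measurable_fun setT (fun x => u x 0 j).
Proof. by have [_ + _] := L2_square_integrable u; exact. Qed.

Lemma L2_outside u x : ~ D x -> u x = 0.
Proof. by have [+ _ _] := L2_square_integrable u; exact. Qed.

Lemma L2_class f : square_integrable mu D f ->
  exists u, {ae mu, forall x, u x = f x}.
Proof.
move=> /asboolP sf; exists (\pi_(L2)%qT (Sqfun sf)).
exact: (L2_pi (Sqfun sf)).
Qed.

Lemma L2_scaleE a u : {ae mu, forall x, (a *: u : L2) x = a *: u x}.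
Proof. exact: L2Z. Qed.

Lemma L2_0 : {ae mu, forall x, (0 : L2) x = 0}.
Proof.
by rewrite -(scale0r (0 : L2)); apply: filterS (L2_scaleE 0 0) => x ->; rewrite scale0r.
Qed.

Lemma L2B u v : {ae mu, forall x, (u - v : L2) x = u x - v x}.
Proof.
rewrite -scaleN1r; apply: filterS2 (L2D u (-1 *: v)) (L2_scaleE (-1) v).
by move=> x -> ->; rewrite scaleN1r.
Qed.

Lemma L2_innerE u v : inner u v = \int[mu]_x inner (u x) (v x).
Proof. by []. Qed.

Lemma L2_hnorm_sqrE u : ((hnorm u ^+ 2)%:E = \int[mu]_x (inner (u x) (u x))%:E)%E.
Proof.
rewrite sqr_hnorm L2_innerE fineK//.
exact/integrable_fin_num/integrable_L2_inner.
Qed.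

Lemma square_integrable_le f h (C : R) : 0 <= C -> square_integrable mu D h ->
  measurable_coord f -> (forall x, ~ D x -> f x = 0) ->
  {ae mu, forall x, inner (f x) (f x) <= C * inner (h x) (h x)} ->
  square_integrable mu D f.
Proof.
move=> C0 [_ mh hoo] mf f0 fh; split => //.
apply: (@le_lt_trans _ _ (\int[mu]_x (C%:E * (inner (h x) (h x))%:E))%E).
  apply: ae_ge0_le_integral => //.
  - by move=> x _; rewrite lee_fin inner_ge0.
  - exact/measurable_EFinP/measurable_inner.
  - by move=> x _; rewrite mule_ge0// lee_fin inner_ge0.
  - by apply: measurable_funeM; exact/measurable_EFinP/measurable_inner.
  - by apply: filterS fh => x fx _; rewrite -EFinM lee_fin.
rewrite ge0_integralZl//.
- by rewrite lte_mul_pinfty// lee_fin.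
- exact/measurable_EFinP/measurable_inner.
- by move=> x _; rewrite lee_fin inner_ge0.
Qed.

(** Choose indices with $\|F_{\varphi(j)}\|^2 \le 2^{-(j+1)}$: the sum of the squared pointwise
    norms is then integrable, so finite almost everywhere, and its terms tend to 0. The bound
    [j <= phi j] serves in place of strict monotonicity. *)
Lemma L2_ae_subsequence (F : nat -> L2) : hnorm (F k) @[k --> \oo] --> (0 : R) ->
  exists phi : nat -> nat, (forall j, (j <= phi j)%N) /\
    {ae mu, forall x, hnorm (F (phi j) x) @[j --> \oo] --> (0 : R)}.
Proof.
move=> /cvgr0P F0.
have /choice[phi phiP] : forall j, exists k, (j <= k)%N /\ hnorm (F k) ^+ 2 <= 1 / (2 ^ j.+1)%:R.
  move=> j; have e0 : 0 < Num.sqrt (1 / (2 ^ j.+1)%:R) :> R.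
    by rewrite sqrtr_gt0 divr_gt0// ltr0n expn_gt0.
  have [N _ NP] := F0 _ e0; exists (maxn N j); split; first exact: leq_maxr.
  have := NP (maxn N j) (leq_maxl _ _).
  rewrite /= ger0_norm ?hnorm_ge0// => h.
  rewrite -[leRHS]sqr_sqrtr; last by rewrite divr_ge0.
  by rewrite ler_sqr ?nnegrE ?hnorm_ge0 ?sqrtr_ge0 ?ltW.
exists phi; split => [j|]; first exact: (phiP j).1.
pose a j x := (inner (F (phi j) x) (F (phi j) x))%:E.
have a0 j x : (0 <= a j x)%E by rewrite lee_fin inner_ge0.
have ma j : measurable_fun setT (a j).
  apply/measurable_EFinP/measurable_inner => i; exact: measurable_L2.
have suma : (\int[mu]_x (\sum_(j <oo) a j x) < +oo)%E.
  rewrite integral_nneseries//.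
  apply: (@le_lt_trans _ _ (\sum_(j <oo) (1 / (2 ^ j.+1)%:R)%:E)%E).
    apply: lee_nneseries => j _ /=.
      by move=> _; apply: integral_ge0.
    by rewrite -L2_hnorm_sqrE lee_fin (phiP j).2.
  by apply: le_lt_trans (epsilon_trick0 _ ler01) _; exact: ltry.
have inta : mu.-integrable setT (fun x => \sum_(j <oo) a j x)%E.
  apply/integrableP; split; first exact: ge0_emeasurable_sum.
  by under eq_integral do rewrite gee0_abs ?nneseries_ge0//.
have := integrable_ae measurableT inta; apply: filterS => x /(_ I) fx.
have : (\sum_(j <oo) a j x < +oo)%E by rewrite ltey_eq fx.
move=> /nneseries_tail_cvg/(_ (fun j _ => a0 j x)) tail.
have ax : a ^~ x @ \oo --> 0%E.
  apply: squeeze_cvge (cvg_cst 0%E) tail; apply: nearW => k.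
  rewrite a0/=.
  have := @nneseries_lim_ge _ (a ^~ x) xpredT k k.+1 (fun i _ _ => a0 i x).
  by rewrite big_nat1.
apply/cvgr0P => e e0; have e2 : 0 < e ^+ 2 by rewrite exprn_gt0.
have /fine_cvgP[_ /cvgr0P/(_ _ e2)] := ax; apply: filterS => k /=.
rewrite /a/= -sqr_hnorm ger0_norm ?sqr_ge0// ger0_norm ?hnorm_ge0//.
by rewrite ltr_pXn2r// nnegrE ?hnorm_ge0 ?ltW.
Qed.

Lemma L2_dominated_cvg0 (F : nat -> L2) (rho : T -> R) :
  mu.-integrable setT (EFin \o rho) ->
  (forall k, {ae mu, forall x, inner (F k x) (F k x) <= rho x}) ->
  {ae mu, forall x, hnorm (F k x) @[k --> \oo] --> (0 : R)} ->
  hnorm (F k) @[k --> \oo] --> (0 : R).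
Proof.
move=> irho Frho Fx.
pose a k x := (inner (F k x) (F k x))%:E.
have [|||||_ _ ] := @dominated_convergence _ _ _ mu setT measurableT a (cst 0%E)
  (EFin \o rho).
- move=> k; apply/measurable_EFinP/measurable_inner => i; exact: measurable_L2.
- exact: measurable_cst.
- apply: filterS Fx => x /cvgr0P Fx _; apply/fine_cvgP; split.
    by exists 0%N.
  apply/cvgr0P => e e0.
  have e1 : 0 < Num.sqrt e by rewrite sqrtr_gt0.
  apply: filterS (Fx _ e1) => k /=; rewrite !ger0_norm ?hnorm_ge0 ?inner_ge0//.
  by rewrite /hnorm ltr_sqrt.
- exact: irho.
- have := ae_foralln Frho; apply: filterS => x hx k _.
  by rewrite gee0_abs// lee_fin ?inner_ge0//; exact: hx.
rewrite integral0 => /fine_cvgP[_ /cvgr0P c0]; apply/cvgr0P => e e0.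
have e2 : 0 < e ^+ 2 by rewrite exprn_gt0.
apply: filterS (c0 _ e2) => k /=; rewrite /a -L2_hnorm_sqrE/=.
rewrite ger0_norm ?sqr_ge0// ger0_norm ?hnorm_ge0//.
by rewrite ltr_pXn2r// nnegrE ?hnorm_ge0 ?ltW.
Qed.

Lemma measurable_fun_if0 (E : set T) (a : T -> R) : measurable E ->
  measurable_fun E a -> measurable_fun setT (fun x => if x \in E then a x else 0).
Proof.
move=> mE ma; rewrite (_ : (fun _ => _) = a \_ E).
  exact: (measurable_restrictT a mE).1.
by apply/funext => x; rewrite patchE.
Qed.

Lemma square_integrable_bounded f (E : set T) (C : R) : measurable E ->
  (mu E < +oo)%E -> E `<=` D -> 0 <= C -> measurable_coord f ->
  (forall x, ~ E x -> f x = 0) -> (forall x, E x -> inner (f x) (f x) <= C) ->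
  square_integrable mu D f.
Proof.
move=> mE Eoo ED C0 mf f0 fC; split => // [x Dx|]; first by apply: f0 => /ED.
apply: (@le_lt_trans _ _ (\int[mu]_x ((cst C%:E) \_ E) x)%E).
  apply: ge0_le_integral => //.
  - by move=> x _; rewrite lee_fin inner_ge0.
  - exact/measurable_EFinP/measurable_inner.
  - by apply: (measurable_restrictT (cst C%:E) mE).1; exact: measurable_cst.
  move=> x _; rewrite patchE; case: ifPn => [xE|xE].
    by rewrite lee_fin; apply: fC; exact: set_mem.
  by rewrite f0 ?inner0l// => /mem_set; exact/negP.
by rewrite -integral_mkcond integral_cst// lte_mul_pinfty.
Qed.

End L2_tools.

(** * Subdifferentials of integral functionals *)

(** Replace [f] by its minimum with [h]: it agrees with [f] almost everywhere and lies below [h]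
    everywhere. *)
Lemma ae_le_integral d (T : measurableType d) (R : realType)
    (mu : {measure set T -> \bar R}) (D : set T) (f h : T -> \bar R) :
  measurable D -> mu.-integrable D f -> mu.-integrable D h ->
  {ae mu, forall x, D x -> (f x <= h x)%E} ->
  (\int[mu]_(x in D) f x <= \int[mu]_(x in D) h x)%E.
Proof.
move=> mD intf inth fh.
have mf := measurable_int mu intf; have mh := measurable_int mu inth.
have mm : measurable_fun D (fun x => mine (f x) (h x)) by exact: measurable_mine.
rewrite (ae_eq_integral (fun x => mine (f x) (h x)))//; last first.
  by apply: filterS fh => x fhx Dx; rewrite (min_idPl (fhx Dx)).
apply: le_integral => //; last by move=> x _; rewrite ge_min lexx orbT.
apply/integrableP; split => //.
apply: (@le_lt_trans _ _ (\int[mu]_(x in D) (`|f x| + `|h x|))%E).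
  apply: ge0_le_integral => //.
  - exact: measurableT_comp.
  - by apply: emeasurable_funD; exact: measurableT_comp.
  - move=> x _; rewrite minEle; case: ifPn => _; first by rewrite leeDl.
    by rewrite leeDr.
rewrite ge0_integralD//; [|exact: measurableT_comp..].
by rewrite lte_add_pinfty//; [case/integrableP: intf|case/integrableP: inth].
Qed.

Lemma ae_filter_lebesgueRn (R : realType) (n : nat) :
  Filter (almost_everywhere (lebesgueRn_measure R n)).
Proof.
exact: (ae_filter_ringOfSetsType (lebesgueRn_measure R n : {measure set _ -> \bar R})).
Qed.

#[local] Hint Extern 0 (Filter (almost_everywhere (lebesgueRn_measure _ _))) =>
  (apply: ae_filter_lebesgueRn) : typeclass_instances.
#[local] Hint Extern 0 (Filter (nbhs (almost_everywhere (lebesgueRn_measure _ _)))) =>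
  (apply: ae_filter_lebesgueRn) : typeclass_instances.

Section subdifferential_integral_functional.
Context (R : realType) (n m : nat) (Omega : set 'rV[R]_n).
Context (g : 'rV[R]_n -> 'rV[R]_m -> \bar R).
Local Notation T := (lebesgueRn R n).
Local Notation D := (Omega : set T).
Local Notation mu := (lebesgueRn_measure R n).
Local Notation L2 := (L2Rn Omega m).
Hypotheses (ng : normal_integrand Omega g)
  (gpc : forall x, Omega x -> proper_ereal (g x) /\ convex_ereal (g x)).
Local Notation G := (integral_functional g : L2 -> \bar R).
Hypothesis propG : proper_ereal G.
Implicit Types (u v xi : L2).

Let clg x : Omega x -> closed (epigraph (g x)).
Proof. by case: ng => + _; apply. Qed.
Let prg x : Omega x -> proper_ereal (g x).
Proof. by move=> /gpc[]. Qed.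
Let cvg_ x : Omega x -> convex_ereal (g x).
Proof. by move=> /gpc[]. Qed.
Let mD : measurable D := integrand_domain_measurable ng gpc.

Let mg u : measurable_fun D (fun x => g x (u x)).
Proof. exact: (measurable_integrand ng gpc (measurable_L2 u)). Qed.

(** With $+\infty - \infty = +\infty$, a value below $+\infty$ makes the positive part integrable;
    as properness excludes $-\infty$, the negative part is integrable as well. *)
Lemma integral_functional_lty_integrable u : (G u < +oo)%E ->
  mu.-integrable D (fun x => g x (u x)) /\ G u = (\int[mu]_(x in D) g x (u x))%E.
Proof.
have /(_ u) := propG.1; rewrite /integral_functional.
set a := (\int[mu]_(x in _) _)%E; set b := (\int[mu]_(x in _) (_^\- _)%E)%E.
move=> GNy Goo.
have a0 : (0 <= a)%E by apply: integral_ge0 => x _; exact: funepos_ge0.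
have b0 : (0 <= b)%E by apply: integral_ge0 => x _; exact: funeneg_ge0.
have [aoo boo] : (a < +oo)%E /\ (b < +oo)%E.
  by move: a b a0 b0 GNy Goo => [a||] [b||] //= _ _ _ _; split; exact: ltry.
split.
  apply/integrableP; split; first exact: mg.
  rewrite -[X in (integral _ _ X < _)%E]/(abse \o _) fune_abse ge0_integralD//.
  - by rewrite lte_add_pinfty.
  - exact: measurable_funepos.
  - exact: measurable_funeneg.
rewrite integralE -/a -/b.
by move: a b a0 b0 GNy Goo aoo boo => [a||] [b||].
Qed.

(** Finiteness of [G u] is a consequence: the positive part of $g(x,u(x))$ is dominated by that of
    an integrable function. Both directions of the pointwise description of the subdifferential rest
    on this comparison. *)
Lemma integral_functional_le u v (h : T -> R) : (G v < +oo)%E ->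
  mu.-integrable D (EFin \o h) ->
  {ae mu, forall x, Omega x -> (g x (u x) <= g x (v x) + (h x)%:E)%E} ->
  (G u <= G v + (\int[mu]_(x in D) h x)%:E)%E.
Proof.
move=> Gv inth uv; have [intv ->] := integral_functional_lty_integrable Gv.
have intvh : mu.-integrable D (fun x => g x (v x) + (h x)%:E)%E.
  exact: integrableD.
have Gu : (G u < +oo)%E.
  rewrite /integral_functional.
  set a := (\int[mu]_(x in _) _)%E; set b := (\int[mu]_(x in _) (_^\- _)%E)%E.
  have b0 : (0 <= b)%E by apply: integral_ge0 => x _; exact: funeneg_ge0.
  suff aoo : (a < +oo)%E.
    by move: a b b0 aoo => [a||] [b||] //= _ _; exact: ltry.
  apply: le_lt_trans (integral_funepos_lt_pinfty mD intvh).
  apply: ae_ge0_le_integral => //.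
  - exact: measurable_funepos.
  - by apply: measurable_funepos; exact: measurable_int intvh.
  - by apply: filterS uv => x uvx /uvx fh; rewrite !funeposE ge_max !le_max fh lexx orbT.
have [intu ->] := integral_functional_lty_integrable Gu.
rewrite fineK; last exact: integrable_fin_num.
by rewrite -integralD//; exact: ae_le_integral.
Qed.

Let Rintegral_inner (u v : L2) :
  \int[mu]_(x in D) inner (u x) (v x) = inner u v.
Proof.
rewrite Rintegral_mkcond L2_innerE; apply: eq_Rintegral => x _.
rewrite patchE; case: ifPn => // /negP xD.
by rewrite L2_outside ?inner0l// => /mem_set.
Qed.

Let integrable_inner_L2 (u v : L2) :
  mu.-integrable D (EFin \o (fun x => inner (u x) (v x))).
Proof. by apply: integrableS (integrable_L2_inner u v). Qed.

Lemma ae_subdifferential u xi :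
  {ae mu, forall x, Omega x -> subdifferential (g x) (u x) (xi x)} ->
  subdifferential G u xi.
Proof.
move=> uxi v; have [Gv|] := ltP (G v) +oo%E; last by apply: le_trans; rewrite leey.
(* The inner product changes side to reach the form of [integral_functional_le]. *)
suff : (G u <= G v + (inner xi (- (v - u)))%:E)%E.
  rewrite innerNr; move: (propG.1 u) (propG.1 v) Gv.
  case: (G u) (G v) => [a||] [b||]//= _ _ _; rewrite ?leeNy_eq// -!EFinD !lee_fin; lra.
rewrite -Rintegral_inner.
apply: integral_functional_le Gv (integrable_inner_L2 xi (- (v - u))) _.
have L2N : {ae mu, forall x, (- (v - u) : L2) x = - ((v : L2) x - u x)}.
  rewrite -scaleN1r; apply: filterS2 (L2_scaleE (-1) (v - u)) (L2B v u).
  by move=> x -> ->; rewrite scaleN1r.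
apply: filterS2 L2N uxi => x -> uxi Ox.
have := uxi Ox ((v : L2) x); have [a ->] := subdifferential_fin (prg Ox) (uxi Ox).
rewrite innerNr; case: (g x ((v : L2) x)) => [b||]; last by rewrite -EFinD leeNy_eq.
  by rewrite -!EFinD !lee_fin; lra.
by move=> _; rewrite addye // leey.
Qed.

Lemma subdifferential_ae u xi : subdifferential G u xi ->
  {ae mu, forall x, Omega x -> subdifferential (g x) (u x) (xi x)}.
Proof.
move=> Guxi; have [c Gu] := subdifferential_fin propG Guxi.
pose y x := prox (g x) (u x + xi x).
have my j : measurable_fun D (fun x => y x 0 j).
  apply: (measurable_prox ng gpc) => i.
  rewrite (_ : (fun _ => _) = (fun x => u x 0 i + xi x 0 i)).
    by apply: measurable_funD; exact: measurable_L2.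
  by apply/funext => x; rewrite mxE.
(* On [E k], of finite measure, the increment [y - u] is bounded, so its truncation is
   square-integrable; these sets exhaust [Omega]. *)
pose E k := D `&` (halfopen_cube k `&` [set x | inner (y x - u x) (y x - u x) <= k%:R]).
have mE k : measurable (E k).
  have mI : measurable_fun D (fun x => inner (y x - u x) (y x - u x)).
    apply: measurable_sum => i.
    have mi : measurable_fun D (fun x => (y x - u x) 0 i).
      rewrite (_ : (fun _ => _) = (fun x => y x 0 i - u x 0 i)).
        exact: (measurable_funB (my _) (measurable_funTS (measurable_L2 u _))).
      by apply/funext => x; rewrite !mxE.
    exact: measurable_funM.
  rewrite /E setICA; apply: measurableI; first exact: measurable_halfopen_cube.
  by have := mI mD _ (@measurable_itv R `]-oo, k%:R]); rewrite set_itvNyc.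
have Eae k : {ae mu, forall x, E k x -> y x = u x}.
  pose f x := if x \in E k then y x - u x else 0.
  have fE x : E k x -> f x = y x - u x by move=> Ex; rewrite /f mem_set.
  have fN x : ~ E k x -> f x = 0.
    by move=> Ex; rewrite /f; case: ifPn => // /set_mem.
  have mf j : measurable_fun setT (fun x => f x 0 j).
    rewrite (_ : (fun _ => _) = (fun x => if x \in E k then y x 0 j - u x 0 j else 0)).
      apply: (measurable_fun_if0 (mE k)); apply: (measurable_funS mD) => [x []//|].
      exact: (measurable_funB (my _) (measurable_funTS (measurable_L2 u _))).
    by apply/funext => x; rewrite /f; case: ifPn => xE; rewrite !mxE.
  have Eoo : (mu (E k) < +oo)%E.
    apply: le_lt_trans (halfopen_cube_lty R n k); apply: le_measure.
    - by rewrite inE; exact: mE.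
    - by rewrite inE; exact: measurable_halfopen_cube.
    - by move=> x [_ []].
  have sf : square_integrable mu D f.
    apply: (square_integrable_bounded (mE k) Eoo _ (ler0n R k) mf fN) => [x []//|x Ex].
    by rewrite fE//; exact: Ex.2.2.
  have [w wf] := L2_class sf.
  (* The proximal point $u + w$ has subgradient $\xi - w$. Integration gives $G(u+w) \le G(u) +
     \langle \xi - w, w\rangle$, while $\xi$ gives $G(u) + \langle \xi, w\rangle \le G(u+w)$; hence
     $\langle w, w\rangle \le 0$. *)
  have h : {ae mu, forall x, Omega x ->
      (g x ((u + w : L2) x) <= g x (u x) + (inner ((xi - w : L2) x) (w x))%:E)%E}.
    apply: filterS3 (L2D u w) (L2B xi w) wf => x -> -> -> Ox.
    have [Ex|Ex] := pselect (E k x); last first.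
      by rewrite fN// inner0r addr0 adde0.
    rewrite fE// addrC subrK.
    have py := prox_subdifferential (clg Ox) (prg Ox) (cvg_ Ox) (u x + xi x).
    have := py (u x); have [a ->] := subdifferential_fin (prg Ox) py.
    rewrite -/(y x) -(opprB (y x) (u x)) innerNr.
    have -> : u x + xi x - y x = xi x - (y x - u x) by rewrite opprB [_ + xi x]addrC -addrA.
    case: (g x (u x)) => [b||]; last by rewrite -EFinD leeNy_eq.
      by rewrite -!EFinD !lee_fin lerBlDr.
    by move=> _; rewrite addye // leey.
  have Guoo : (G u < +oo)%E by rewrite Gu ltry.
  have := integral_functional_le Guoo (integrable_inner_L2 (xi - w) w) h.
  rewrite Rintegral_inner => /(le_trans (Guxi _)).
  rewrite Gu [u + w]addrC addrK -!EFinD lee_fin innerBl lerD2l lerBrDr gerDl => h2.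
  have w0 : w = 0 by apply: inner_eq0; apply/eqP; rewrite eq_le inner_ge0 h2.
  apply: filterS2 wf (L2_0 mu D m) => x; rewrite w0 => -> + Ex.
  by rewrite fE// => /subr0_eq.
have := ae_foralln Eae; apply: filterS => x Ex Ox.
apply/(subdifferential_prox (clg Ox) (prg Ox) (cvg_ Ox)).
apply/esym; have [k1 _ xk1] : (\bigcup_k @halfopen_cube R n k) x by rewrite bigcup_halfopen_cube.
pose k2 := (Num.truncn (inner (y x - u x) (y x - u x))).+1.
apply: (Ex (maxn k1 k2)); split => //; split.
  exact: halfopen_cubeS (leq_maxl _ _) _ xk1.
rewrite /=; apply: le_trans (ltW (truncnS_gt _)) _.
by rewrite ler_nat leq_maxr.
Qed.

End subdifferential_integral_functional.

(** * Graphical derivatives *)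

Lemma filterS4 T (F : set_system T) : Filter F -> forall P Q R S U : set T,
  (forall x, P x -> Q x -> R x -> S x -> U x) -> F P -> F Q -> F R -> F S -> F U.
Proof.
move=> FF P Q R S U PQRSU FP FQ FR FS.
have FPQ : F (P `&` Q) by exact: filterI.
by apply: filterS3 FPQ FR FS => x [? ?] ? ?; exact: PQRSU.
Qed.

Lemma filterS5 T (F : set_system T) : Filter F -> forall P Q R S U V : set T,
  (forall x, P x -> Q x -> R x -> S x -> U x -> V x) ->
  F P -> F Q -> F R -> F S -> F U -> F V.
Proof.
move=> FF P Q R S U V PQRSUV FP FQ FR FS FU.
have FPQ : F (P `&` Q) by exact: filterI.
by apply: filterS4 FPQ FR FS FU => x [? ?] ? ? ?; exact: PQRSUV.
Qed.

Lemma cvgr0_subseq (R : realType) (f : nat -> R) (phi : nat -> nat) :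
  (forall j, (j <= phi j)%N) -> f @ \oo --> (0 : R) ->
  f (phi j) @[j --> \oo] --> (0 : R).
Proof.
move=> jphi /cvgr0P f0; apply/cvgr0P => e /f0[N _ NP].
by exists N => // j /= Nj; apply: NP => /=; exact: leq_trans Nj (jphi j).
Qed.

Lemma sqr_le_add (R : realType) (a b c : R) : 0 <= a -> a <= b + c ->
  a ^+ 2 <= 2 * b ^+ 2 + 2 * c ^+ 2.
Proof.
move=> a0 abc; apply: (@le_trans _ _ ((b + c) ^+ 2)); last first.
  by have := sqr_ge0 (b - c); lra.
by rewrite ler_sqr ?nnegrE//; exact: le_trans abc.
Qed.

Section L2_pairs.
Context d (T : measurableType d) (R : realType).
Variables (mu : {measure set T -> \bar R}) (D : set T) (m : nat).
Local Notation L2 := (L2 mu D m).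

Lemma L2_pair_ae_subsequence (F : nat -> L2 * L2) :
  hnorm (F k) @[k --> \oo] --> (0 : R) ->
  exists phi : nat -> nat, (forall j, (j <= phi j)%N) /\
    {ae mu, forall x, hnorm ((F (phi j)).1 x, (F (phi j)).2 x) @[j --> \oo] --> (0 : R)}.
Proof.
move=> /cvgr0P F0.
have F1 : hnorm (F k).1 @[k --> \oo] --> (0 : R).
  apply/cvgr0P => e /F0; apply: filterS => k; rewrite !ger0_norm ?hnorm_ge0//.
  exact/le_lt_trans/hnorm_fst_le.
have [phi1 [phi1j ae1]] := L2_ae_subsequence F1.
have F2 : hnorm (F k).2 @[k --> \oo] --> (0 : R).
  apply/cvgr0P => e /F0; apply: filterS => k; rewrite !ger0_norm ?hnorm_ge0//.
  exact/le_lt_trans/hnorm_snd_le.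
have F2phi := cvgr0_subseq phi1j F2.
have [phi2 [phi2j ae2]] := L2_ae_subsequence F2phi.
exists (phi1 \o phi2); split => [j|].
  exact: leq_trans (phi2j j) (phi1j _).
apply: filterS2 ae1 ae2 => x x1 x2.
have {}x1 := cvgr0_subseq phi2j x1.
apply/cvgr0P => e e0; have e2 : 0 < e / 2 by rewrite divr_gt0.
move/cvgr0P : x1 => /(_ _ e2) x1; move/cvgr0P : x2 => /(_ _ e2).
apply: filterS2 x1 => j; rewrite !ger0_norm ?hnorm_ge0// => h1 h2.
apply: le_lt_trans (hnorm_prod_le _) _.
by rewrite (splitr e) ltrD.
Qed.

End L2_pairs.

Section pointwise_derivatives.
Context (R : realType) (n m : nat) (Omega : set 'rV[R]_n).
Context (g : 'rV[R]_n -> 'rV[R]_m -> \bar R).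
Local Notation T := (lebesgueRn R n).
Local Notation D := (Omega : set T).
Local Notation mu := (lebesgueRn_measure R n).
Local Notation L2 := (L2Rn Omega m).
Hypothesis rg : regular_integrand Omega g.
Local Notation G := (integral_functional g : L2 -> \bar R).
Hypothesis propG : proper_ereal G.
Implicit Types (u v xi : L2).
Local Notation graphG := (graph (subdifferential G)).
Local Notation graphg x := (graph (subdifferential (g x))).

Lemma regular_integrand_normal : normal_integrand Omega g.
Proof. by case: rg. Qed.
Let ng := regular_integrand_normal.
Let gpc x : Omega x -> proper_ereal (g x) /\ convex_ereal (g x).
Proof. by case: rg => _ + _; apply. Qed.
Let gproto : {ae mu, forall x, Omega x -> proto_differentiable (subdifferential (g x))}.
Proof. by case: rg. Qed.
Let clg x : Omega x -> closed (epigraph (g x)).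
Proof. by case: ng => + _; apply. Qed.
Let prg x : Omega x -> proper_ereal (g x).
Proof. by move=> /gpc[]. Qed.
Let cvg_ x : Omega x -> convex_ereal (g x).
Proof. by move=> /gpc[]. Qed.
Let mD : measurable D.
Proof. exact: integrand_domain_measurable ng gpc. Qed.

Lemma ae_tangent u xi (w : L2 * L2) : tangent_cone graphG (u, xi) w ->
  {ae mu, forall x, Omega x ->
    tangent_cone (graphg x) (u x, xi x) (w.1 x, w.2 x)}.
Proof.
move=> [Guxi [tau [v [tau0 tauc Gv vw]]]].
pose F k := (tau k)^-1 *: (v k - (u, xi)) - w.
have [phi [phij aeF]] := L2_pair_ae_subsequence (F := F) vw.
have ae1 := ae_foralln (fun k => subdifferential_ae ng gpc propG (Gv k)).
(* Linear operations act on representatives only almost everywhere; one null set is discarded for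
   each index [k]. *)
have comp (a b c : L2) (t : R) : {ae mu, forall x,
    (t *: (a - b) - c : L2) x = t *: (a x - b x) - c x}.
  apply: filterS3 (L2B (t *: (a - b)) c) (L2_scaleE t (a - b)) (L2B a b).
  by move=> x -> -> ->.
have ae2 := ae_foralln (fun k => comp (v k).1 u w.1 (tau k)^-1).
have ae3 := ae_foralln (fun k => comp (v k).2 xi w.2 (tau k)^-1).
apply: filterS5 ae1 ae2 ae3 aeF (subdifferential_ae ng gpc propG Guxi).
move=> x x1 x2 x3 xF ux Ox; split; first exact: ux.
exists (tau \o phi), (fun j => (((v (phi j)).1 : L2) x, ((v (phi j)).2 : L2) x)); split.
- by move=> j; exact: tau0.
- exact: cvgr0_subseq phij tauc.
- by move=> j; exact: x1.
- rewrite (_ : (fun j => _) =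
    (fun j => hnorm (((F (phi j)).1 : L2) x, ((F (phi j)).2 : L2) x)))//.
  by apply/funext => j; rewrite /F/= x2 x3.
Qed.

Lemma tangent_of_ae u xi (w : L2 * L2) :
  {ae mu, forall x, Omega x ->
    tangent_cone (graphg x) (u x, xi x) (w.1 x, w.2 x)} ->
  tangent_cone graphG (u, xi) w.
Proof.
move=> tw.
have Guxi : subdifferential G u xi.
  by apply: ae_subdifferential => //; apply: filterS tw => x + Ox => /(_ Ox)[].
pose d : L2 := w.1 + w.2.
pose tau k : R := k.+1%:R^-1.
have tau0 k : 0 < tau k by rewrite invr_gt0 ltr0n.
(* Minty parameters moving in the direction [w.1 + w.2]; their proximal points form the
   approximating sequence. *)
pose s k : L2 := (u + xi) + tau k *: d.
have sE k : {ae mu, forall x, s k x = u x + xi x + tau k *: (w.1 x + w.2 x)}.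
  apply: filterS4 (L2D (u + xi) (tau k *: d)) (L2D u xi) (L2_scaleE (tau k) d) (L2D w.1 w.2).
  by move=> x -> -> -> ->.
pose f k x := if x \in D then prox (g x) (s k x) - u x else 0.
have mf k j : measurable_fun setT (fun x => f k x 0 j).
  rewrite (_ : (fun _ => _) = (fun x => if x \in D then prox (g x) (s k x) 0 j - u x 0 j else 0)).
    apply: (measurable_fun_if0 mD); apply: measurable_funB.
      exact: (measurable_prox ng gpc (measurable_L2 (s k))).
    by apply: measurable_funTS; exact: measurable_L2.
  by apply/funext => x; rewrite /f; case: ifPn => xD; rewrite !mxE.
have uprox : {ae mu, forall x, Omega x -> u x = prox (g x) (u x + xi x)}.
  apply: filterS (subdifferential_ae ng gpc propG Guxi) => x ux Ox.
  exact: (subdifferential_prox (clg Ox) (prg Ox) (cvg_ Ox) _ _).1 (ux Ox).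
have dE : {ae mu, forall x, d x = w.1 x + w.2 x} by exact: L2D.
(* Nonexpansiveness serves twice: for the square-integrability of the increments and for the
   domination of their quotients. *)
have fle k : {ae mu, forall x, hnorm (f k x) <= tau k * hnorm (d x)}.
  apply: filterS3 (sE k) uprox dE => x sx ux dx; rewrite /f; case: ifPn => xD.
    have Ox := set_mem xD; rewrite sx {2}(ux Ox) -dx.
    apply: le_trans (prox_lipschitz (clg Ox) (prg Ox) (cvg_ Ox) _ _) _.
    by rewrite addrAC subrr add0r hnormZ gtr0_norm.
  by rewrite hnorm0 mulr_ge0 ?hnorm_ge0 ?ltW.
have f0 k x : ~ D x -> f k x = 0.
  by move=> Dx; rewrite /f; case: ifPn => // /set_mem.
have sf k : square_integrable mu D (f k).
  apply: (square_integrable_le (sqr_ge0 (tau k)) (L2_square_integrable d) (mf k) (f0 k)).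
  apply: filterS (fle k) => x fx; rewrite -!sqr_hnorm -exprMn.
  have t0 := ltW (tau0 k).
  by rewrite ler_sqr ?nnegrE ?mulr_ge0 ?hnorm_ge0.
have /choice[z zf] := fun k => L2_class (sf k).
split; first exact: Guxi.
exists tau, (fun k => (u + z k, s k - (u + z k))); split; first exact: tau0.
- by apply: (@cvgr0_natSinv _ _ 1) => k; rewrite mul1r gtr0_norm; [exact: lexx|exact: tau0].
- move=> k; apply: ae_subdifferential => //.
  apply: filterS3 (L2B (s k) (u + z k)) (L2D u (z k)) (zf k) => x sx uzx zx Ox.
  rewrite sx uzx zx /f mem_set// addrC subrK.
  exact: (prox_subdifferential (clg Ox) (prg Ox) (cvg_ Ox)).
pose F k : L2 := (tau k)^-1 *: z k - w.1.
have F0 : hnorm (F k) @[k --> \oo] --> (0 : R).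
  have FE k : {ae mu, forall x, F k x = (tau k)^-1 *: f k x - w.1 x}.
    apply: filterS3 (L2B ((tau k)^-1 *: z k) w.1) (L2_scaleE (tau k)^-1 (z k)) (zf k).
    by move=> x -> -> ->.
  have irho : mu.-integrable setT
      (EFin \o (fun x => 2 * inner (d x) (d x) + 2 * inner (w.1 x) (w.1 x))).
    have i1 := integrableZl measurableT 2 (integrable_L2_inner d d).
    have i2 := integrableZl measurableT 2 (integrable_L2_inner w.1 w.1).
    exact: (integrableD measurableT i1 i2).
  apply: (L2_dominated_cvg0 irho) => [k|].
    apply: filterS2 (FE k) (fle k) => x -> fx.
    rewrite -!sqr_hnorm.
    have h1 : hnorm ((tau k)^-1 *: f k x) <= hnorm (d x).
      by rewrite hnormZ gtr0_norm ?invr_gt0// ler_pdivrMl.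
    apply: sqr_le_add (hnorm_ge0 _) _; apply: le_trans (hnormB _ _) _.
    by rewrite lerD2r.
  have aeFE := ae_foralln FE; have aesE := ae_foralln sE.
  apply: filterS4 aeFE aesE gproto tw => x FEx sEx px twx.
  have [Ox|Ox] := pselect (Omega x); last first.
    rewrite (_ : (fun k => _) = cst 0); first exact: cvg_cst.
    by apply/funext => k; rewrite (L2_outside (F k))// hnorm0.
  have /cvgr0P dx := prox_curve_derivative (clg Ox) (prg Ox) (cvg_ Ox) (px Ox) (twx Ox).
  apply/cvgr0P => e /dx/near0_rightP[r r0 rP].
  have [N _ NP] := near_infty_natSinv_lt (PosNum r0).
  exists N => // k /NP /= kr; have := rP (tau k); rewrite tau0 => /(_ kr).
  rewrite FEx /f (mem_set (Ox : D x)) sEx; exact.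
(* The components of each quotient add up to [d], so the two errors are opposite and one limit
   suffices. *)
have vF k : (tau k)^-1 *: ((u + z k, s k - (u + z k)) - (u, xi)) - w = (F k, - F k).
  have E1 : s k - (u + z k) - xi = tau k *: d - z k.
    apply/eqP; rewrite /s !subr_eq [tau k *: d - z k + xi]addrAC (addrC u (z k)).
    by rewrite addrA subrK [eqbLHS]addrC (addrC u) addrA.
  rewrite [w]surjective_pairing; congr (_, _).
    by rewrite /= [u + z k]addrC addrK.
  rewrite /= E1 scalerBr scalerA mulVf ?gt_eqF// scale1r opprB.
  by rewrite addrAC addrK.
apply/cvgr0P => e e0; have e2 : 0 < e / 2 by rewrite divr_gt0.
move/cvgr0P : F0 => /(_ _ e2); apply: filterS => k.
rewrite !ger0_norm ?hnorm_ge0// vF => Fe; apply: le_lt_trans (hnorm_prod_le _) _.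
by rewrite /= hnormN (splitr e) ltrD.
Qed.

End pointwise_derivatives.

(** * Coderivatives *)

(** Completing the square: $2e(lc) - (lc)^2 = e^2 - (e - lc)^2$. The bound is independent of the
    scale $l$. *)
Lemma near_scaled_square (R : realType) (i q c l e : R) : 0 <= l -> 0 <= c ->
  q = c ^+ 2 -> i <= e * c -> 2 * l * i - l ^+ 2 * q <= e ^+ 2.
Proof.
move=> l0 c0 -> ie; have h : l * i <= l * (e * c) by rewrite ler_wpM2l.
have := sqr_ge0 (e - l * c); nra.
Qed.

Lemma ae_forall_count d (T : measurableType d) (R : realType)
    (mu : {measure set T -> \bar R}) (I : countType) (P : I -> T -> Prop) :
  (forall i, {ae mu, forall x, P i x}) -> {ae mu, forall x i, P i x}.
Proof.
move=> aeP.
have : {ae mu, forall x k, if unpickle k is Some i then P i x else True}.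
  apply: ae_foralln => k; case: (unpickle k) => [i|]; first exact: aeP.
  exact: aeW.
by apply: filterS => x Px i; have := Px (pickle i); rewrite pickleK.
Qed.

Lemma tangent_cone0 (R : realType) (V : innerProductType R) (U : set V) u :
  U u -> tangent_cone U u 0.
Proof.
move=> Uu; split => //; exists (fun k => k.+1%:R^-1), (fun=> u); split => //.
- apply: (@cvgr0_natSinv _ _ 1) => k; rewrite mul1r ger0_norm ?invr_ge0//.
- rewrite (_ : (fun k => _) = cst 0); first exact: cvg_cst.
  by apply/funext => k; rewrite subrr scaler0 subr0 hnorm0.
Qed.

Section L2_pair_inner.
Context d (T : measurableType d) (R : realType).
Variables (mu : {measure set T -> \bar R}) (D : set T) (m : nat).
Local Notation L2 := (L2 mu D m).
Implicit Types a b : L2 * L2.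

Lemma integrable_L2_pair_inner a b :
  mu.-integrable setT (EFin \o (fun x => inner (a.1 x, a.2 x) (b.1 x, b.2 x))).
Proof.
exact: (integrableD measurableT (integrable_L2_inner a.1 b.1)
  (integrable_L2_inner a.2 b.2)).
Qed.

Lemma L2_pair_innerE a b :
  inner a b = \int[mu]_x inner (a.1 x, a.2 x) (b.1 x, b.2 x).
Proof.
by rewrite prod_innerE !L2_innerE -RintegralD//; exact: integrable_L2_inner.
Qed.

End L2_pair_inner.

Section pointwise_coderivative.
Context (R : realType) (n m : nat) (Omega : set 'rV[R]_n).
Context (g : 'rV[R]_n -> 'rV[R]_m -> \bar R).
Local Notation T := (lebesgueRn R n).
Local Notation D := (Omega : set T).
Local Notation mu := (lebesgueRn_measure R n).
Local Notation L2 := (L2Rn Omega m).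
Hypothesis rg : regular_integrand Omega g.
Local Notation G := (integral_functional g : L2 -> \bar R).
Hypothesis propG : proper_ereal G.
Implicit Types (u v xi : L2).
Local Notation graphG := (graph (subdifferential G)).
Local Notation graphg x := (graph (subdifferential (g x))).

Let ng := regular_integrand_normal rg.
Let gpc x : Omega x -> proper_ereal (g x) /\ convex_ereal (g x).
Proof. by case: rg => _ + _; apply. Qed.
Let gproto : {ae mu, forall x, Omega x -> proto_differentiable (subdifferential (g x))}.
Proof. by case: rg. Qed.
Let clg x : Omega x -> closed (epigraph (g x)).
Proof. by case: ng => + _; apply. Qed.
Let prg x : Omega x -> proper_ereal (g x).
Proof. by move=> /gpc[]. Qed.
Let cvg_ x : Omega x -> convex_ereal (g x).
Proof. by move=> /gpc[]. Qed.
Let mD : measurable D.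
Proof. exact: integrand_domain_measurable ng gpc. Qed.

(** By contradiction: a sequence in the graph violating the normal inequality with constant [e]
    yields functions [rho k] of integral at least $e^2$, while along a subsequence pointwise
    normality and dominated convergence force the integrals to 0. *)
Lemma regular_normal_of_ae u xi (z : L2 * L2) :
  {ae mu, forall x, Omega x ->
    regular_normal_cone (graphg x) (u x, xi x) (z.1 x, z.2 x)} ->
  regular_normal_cone graphG (u, xi) z.
Proof.
move=> nz; apply/regular_normal_coneP; split.
  by apply: (ae_subdifferential ng gpc propG); apply: filterS nz => x + Ox => /(_ Ox)[].
move=> e e0; apply: contrapT => nd.
have /choice[v vP] : forall k : nat, exists v : L2 * L2, [/\ graphG v,
    hnorm (v - (u, xi)) < k.+1%:R^-1 &
    e * hnorm (v - (u, xi)) < inner z (v - (u, xi))].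
  move=> k; apply: contrapT => nv; apply: nd.
  exists k.+1%:R^-1 => [|v Gv vk]; first by rewrite invr_gt0 ltr0n.
  by rewrite leNgt; apply/negP => h; apply: nv; exists v.
pose H k : L2 * L2 := v k - (u, xi).
have H0 : hnorm (H k) @[k --> \oo] --> (0 : R).
  apply: (@cvgr0_natSinv _ _ 1) => k; rewrite mul1r ger0_norm ?hnorm_ge0//.
  by have [_ /ltW] := vP k.
have [phi [phij aeH]] := L2_pair_ae_subsequence H0.
have Hgt0 k : 0 < hnorm (H k).
  rewrite lt_neqAle hnorm_ge0 andbT eq_sym; apply/eqP => Hk0.
  have [_ _] := vP k; rewrite -/(H k) Hk0 mulr0.
  by rewrite (hnorm_eq0 Hk0) inner0r ltxx.
(* [c k] is at most [|z|^2] by completing the square, and its integral is more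
   than [e^2] by the choice of [l k]; it replaces the quotient <z, h>^+ / |h|,
   whose measurability and junk values at [h = 0] would have to be handled. *)
pose l k : R := e / hnorm (H k).
have l0 k : 0 <= l k by rewrite divr_ge0 ?hnorm_ge0 ?ltW.
pose i k x : R := inner (z.1 x, z.2 x) ((H k).1 x, (H k).2 x).
pose q k x : R := inner ((H k).1 x, (H k).2 x) ((H k).1 x, (H k).2 x).
pose c k x : R := 2 * l k * i k x - l k ^+ 2 * q k x.
pose rho k x : R := Num.max 0 (c k x).
have rho_ge0 k x : 0 <= rho k x by rewrite le_max lexx.
have intc k : mu.-integrable setT (EFin \o c k).
  have i1 := integrableZl measurableT (2 * l k) (integrable_L2_pair_inner z (H k)).
  have i2 := integrableZl measurableT (l k ^+ 2) (integrable_L2_pair_inner (H k) (H k)).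
  exact: (integrableB measurableT i1 i2).
have mrho k : measurable_fun setT (EFin \o rho k).
  apply/measurable_EFinP; apply: measurable_maxr; first exact: measurable_cst.
  exact/measurable_EFinP/(measurable_int mu (intc k)).
have rho_le k x : rho k x <= inner (z.1 x, z.2 x) (z.1 x, z.2 x).
  rewrite ge_max inner_ge0/= /c /i /q.
  have := inner_ge0 ((z.1 x, z.2 x) - l k *: ((H k).1 x, (H k).2 x)).
  by rewrite inner_sqB !(innerZr, innerZl); lra.
have rho_ge k : e ^+ 2 <= \int[mu]_x rho k x.
  have irho : mu.-integrable setT (EFin \o rho k).
    apply: (le_integrable measurableT (mrho k)) (integrable_L2_pair_inner z z).
    by move=> x _; rewrite /= lee_fin !ger0_norm ?inner_ge0.
  apply: le_trans (le_Rintegral measurableT (intc k) irho _); last first.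
    by move=> x _; rewrite le_max lexx orbT.
  have i1 := integrableZl measurableT (2 * l k) (integrable_L2_pair_inner z (H k)).
  have i2 := integrableZl measurableT (l k ^+ 2) (integrable_L2_pair_inner (H k) (H k)).
  rewrite RintegralB//.
  rewrite (RintegralZl _ measurableT (integrable_L2_pair_inner z (H k))).
  rewrite (RintegralZl _ measurableT (integrable_L2_pair_inner (H k) (H k))).
  rewrite -!L2_pair_innerE -sqr_hnorm -exprMn.
  have lh : l k * hnorm (H k) = e by rewrite mulfVK ?gt_eqF.
  have [_ _ /ltW zH] := vP k.
  have := ler_wpM2l (l0 k) zH; rewrite mulrCA lh expr2 -(mulrA 2).
  by move: (l k * inner z (H k)) => r; lra.
have rho0 : {ae mu, forall x, setT x -> (rho (phi k) x)%:E @[k --> \oo] --> (0%E : \bar R)}.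
  have ae1 := ae_foralln (fun k => subdifferential_ae ng gpc propG (let: And3 h _ _ := vP k in h)).
  have ae2 := ae_foralln (fun k => L2B (v k).1 u).
  have ae3 := ae_foralln (fun k => L2B (v k).2 xi).
  apply: filterS5 ae1 ae2 ae3 aeH nz => x x1 x2 x3 xH nx _.
  apply/fine_cvgP; split; first by exists 0%N.
  have [Ox|Ox] := pselect (Omega x); last first.
    rewrite (_ : (fun k => _) = cst 0); first exact: cvg_cst.
    apply/funext => k /=; congr EFin; apply/eqP; rewrite eq_le rho_ge0 andbT.
    by apply: le_trans (rho_le _ _) _; rewrite !L2_outside// prod_innerE !inner0l addr0.
  apply/cvgr0P => r r0.
  have [_ nxP] := (regular_normal_coneP _ _ _).1 (nx Ox).
  (* The tolerance is squared by [near_scaled_square], leaving $r/2 < r$. *)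
  have r2 : 0 < Num.sqrt (r / 2) by rewrite sqrtr_gt0 divr_gt0.
  have [dl dl0 dlP] := nxP _ r2.
  move/cvgr0P : xH => /(_ _ dl0); apply: filterS => k.
  rewrite ger0_norm ?hnorm_ge0// => hk /=.
  have Hx : (((v (phi k)).1 : L2) x, ((v (phi k)).2 : L2) x) - (u x, xi x) =
      (((H (phi k)).1 : L2) x, ((H (phi k)).2 : L2) x).
    by rewrite /H /= x2 x3.
  have := dlP (((v (phi k)).1 : L2) x, ((v (phi k)).2 : L2) x) (x1 (phi k) Ox).
  rewrite Hx => /(_ hk) ile.
  have cle := near_scaled_square (l0 (phi k)) (hnorm_ge0 _) (esym (sqr_hnorm _)) ile.
  rewrite ger0_norm//.
  apply: (@le_lt_trans _ _ (r / 2)); last by rewrite ltr_pdivrMr// ltr_pMr// ltr1n.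
  rewrite ge_max divr_ge0 ?(ltW r0)//=; apply: le_trans cle _.
  by rewrite sqr_sqrtr// divr_ge0// ltW.
have [|||||_ _ ] := @dominated_convergence _ _ _ mu setT measurableT
  (fun k => EFin \o rho (phi k)) (cst 0%E)
  (EFin \o (fun x => inner (z.1 x, z.2 x) (z.1 x, z.2 x))).
- by move=> k; exact: mrho.
- exact: measurable_cst.
- exact: rho0.
- exact: integrable_L2_pair_inner.
- by apply: aeW => x k _ /=; rewrite lee_fin ger0_norm.
rewrite integral0 => /fine_cvgP[_ /cvgr0P/(_ (e ^+ 2))].
rewrite exprn_gt0// => /(_ isT)[K _ KP]; have := KP K (leqnn K).
rewrite /= ltNge => /negP; apply; apply: le_trans (rho_ge (phi K)) _.
exact: ler_norm.
Qed.

Lemma ae_regular_normal u xi (z : L2 * L2) :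
  regular_normal_cone graphG (u, xi) z ->
  {ae mu, forall x, Omega x ->
    regular_normal_cone (graphg x) (u x, xi x) (z.1 x, z.2 x)}.
Proof.
move=> nz; have Guxi : subdifferential G u xi by case: nz.
have aeuxi := subdifferential_ae ng gpc propG Guxi.
suff : {ae mu, forall x (q : 'rV[rat]_m), Omega x ->
    exists2 a, tangent_cone (graphg x) (u x, xi x) (a, map_mx ratr q - a) &
    inner (z.1 x, z.2 x) (a, map_mx ratr q - a) <= 0}.
  apply: filterS3 aeuxi gproto => x ux px xq Ox.
  apply: (polar_regular_normal (clg Ox) (prg Ox) (cvg_ Ox) (ux Ox)) => q d.
  have [a ta za] := xq q Ox; exists a => //.
  have := prox_curve_derivative (clg Ox) (prg Ox) (cvg_ Ox) (px Ox) ta.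
  by rewrite [a + (_ - a)]addrC subrK.
apply: ae_forall_count => q; set d := map_mx ratr q.
pose A x := xget 0 [set a | tangent_cone (graphg x) (u x, xi x) (a, d - a)].
(* Removing a measurable null set makes both properties hold at every point of [D'], where [A] can
   be shown measurable. *)
have [N [mN N0 NP]] := filterI aeuxi gproto.
pose D' := D `\` N.
have mD' : measurable D' by exact: measurableD.
have D'P x : D' x -> [/\ Omega x, subdifferential (g x) (u x) (xi x) &
    proto_differentiable (subdifferential (g x))].
  move=> [Ox Nx]; have [h1 h2] : (Omega x -> subdifferential (g x) (u x) (xi x)) /\
     (Omega x -> proto_differentiable (subdifferential (g x))).
    by apply: contrapT => h; apply: Nx; apply: NP.
  by split => //; [exact: h1|exact: h2].
have tA x : D' x -> tangent_cone (graphg x) (u x, xi x) (A x, d - A x).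
  move=> /D'P[Ox ux px].
  have [a ta] := tangent_exists (clg Ox) (prg Ox) (cvg_ Ox) d ux.
  exact: (@xgetI _ 0 [set a | tangent_cone (graphg x) (u x, xi x) (a, d - a)] a).
pose s k x : 'rV[R]_m := u x + xi x + k.+1%:R^-1 *: d.
(* The tangent chosen pointwise by [A] is forced to be the limit of proximal difference quotients;
   this makes an arbitrary choice measurable. *)
have Acvg x j : D' x ->
    k.+1%:R * (prox (g x) (s k x) 0 j - u x 0 j) @[k --> \oo] --> A x 0 j.
  move=> D'x; have [Ox ux px] := D'P x D'x.
  have dx := prox_curve_derivative (clg Ox) (prg Ox) (cvg_ Ox) px (tA x D'x).
  rewrite [A x + _]addrC subrK in dx.
  apply/subr_cvg0/cvgr0P => e e0; move/cvgr0P : dx => /(_ _ e0)/near0_rightP[r r0 rP].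
  have [K _ KP] := near_infty_natSinv_lt (PosNum r0).
  exists K => // k /KP /= kr; have := rP k.+1%:R^-1; rewrite invr_gt0 ltr0n kr => /(_ isT).
  rewrite ger0_norm ?hnorm_ge0// invrK; apply: le_lt_trans.
  by apply: le_trans (ler_coord_hnorm _ j); rewrite !mxE.
have mA j : measurable_fun D' (fun x => A x 0 j).
  apply: measurable_fun_cvg (fun x => @Acvg x j) => k.
  apply: (measurable_funS mD) => [x []//|].
  apply: measurable_funM; first exact: measurable_cst.
  apply: measurable_funB; last by apply: measurable_funTS; exact: measurable_L2.
  apply: (measurable_prox ng gpc) => i.
  rewrite (_ : (fun _ => _) = (fun x => u x 0 i + xi x 0 i + k.+1%:R^-1 * d 0 i)).
    apply: measurable_funD; last exact: measurable_cst.
    by apply: measurable_funD; exact: measurable_L2.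
  by apply/funext => x; rewrite !mxE.
have Ale x : D' x -> hnorm (A x) <= hnorm d.
  move=> D'x; have [Ox ux px] := D'P x D'x.
  have := prox_curve_derivative (clg Ox) (prg Ox) (cvg_ Ox) px (tA x D'x).
  rewrite [A x + _]addrC subrK => dx; apply/ler_addgt0Pr => e e0.
  move/cvgr0P : dx => /(_ _ e0)/near0_rightP[r r0 rP].
  have := rP (r / 2); rewrite divr_gt0// ltr_pdivrMr// ltr_pMr// ltr1n => /(_ isT).
  rewrite ger0_norm ?hnorm_ge0//; set p := _^-1 *: _ => pA.
  have pd : hnorm p <= hnorm d.
    rewrite hnormZ gtr0_norm ?invr_gt0 ?divr_gt0// ler_pdivrMl ?divr_gt0//.
    rewrite {2}((subdifferential_prox (clg Ox) (prg Ox) (cvg_ Ox) _ _).1 ux).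
    apply: le_trans (prox_lipschitz (clg Ox) (prg Ox) (cvg_ Ox) _ _) _.
    by rewrite addrAC subrr add0r hnormZ gtr0_norm ?divr_gt0.
  rewrite -(subKr p (A x)); apply: le_trans (hnormB _ _) _.
  by rewrite lerD// ltW.
(* The set where polarity fails in direction [d]. Cut off to [B] within a cube, the tangent field is
   tangent in $L^2$ (zero is tangent elsewhere), so its inner product with [z] is nonpositive. *)
pose B := D' `&` [set x | 0 < inner (z.1 x, z.2 x) (A x, d - A x)].
have mB : measurable B.
  have mz (a : L2) (h : T -> 'rV[R]_m) : (forall j, measurable_fun D' (fun x => h x 0 j)) ->
      measurable_fun D' (fun x => inner (a x) (h x)).
    move=> mh; apply: measurable_sum => j.
    exact: (measurable_funM (measurable_funTS (measurable_L2 a j)) (mh j)).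
  have mI : measurable_fun D' (fun x => inner (z.1 x, z.2 x) (A x, d - A x)).
    apply: measurable_funD; first exact: mz.
    apply: mz => j; rewrite (_ : (fun _ => _) = (fun x => d 0 j - A x 0 j)).
      by apply: measurable_funB.
    by apply/funext => x; rewrite !mxE.
  by have := mI mD' _ (@measurable_itv R `]0, +oo[); rewrite set_itvoy.
pose E k := B `&` halfopen_cube k.
have mE k : measurable (E k).
  by apply: measurableI => //; exact: measurable_halfopen_cube.
have Eoo k : (mu (E k) < +oo)%E.
  apply: le_lt_trans (halfopen_cube_lty R n k); apply: le_measure.
  - by rewrite inE; exact: mE.
  - by rewrite inE; exact: measurable_halfopen_cube.
  - by move=> x [].
have ED' k : E k `<=` D' by move=> x [[]].
have ED k : E k `<=` D by move=> x /ED'[].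
have Enull k : {ae mu, forall x, ~ E k x}.
  pose cut (h : T -> 'rV[R]_m) x := if x \in E k then h x else 0.
  have cutE h x : E k x -> cut h x = h x by move=> Ex; rewrite /cut mem_set.
  have cutN h x : ~ E k x -> cut h x = 0.
    by move=> Ex; rewrite /cut; case: ifPn => // /set_mem.
  have mcut (h : T -> 'rV[R]_m) j : (forall j, measurable_fun D' (fun x => h x 0 j)) ->
      measurable_fun setT (fun x => cut h x 0 j).
    move=> mh; rewrite (_ : (fun _ => _) = (fun x => if x \in E k then h x 0 j else 0)).
      by apply: (measurable_fun_if0 (mE k)); exact: (measurable_funS mD' (@ED' k) (mh j)).
    by apply/funext => x; rewrite /cut; case: ifPn => xE; rewrite ?mxE.
  have scut (h : T -> 'rV[R]_m) : (forall j, measurable_fun D' (fun x => h x 0 j)) ->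
      (forall x, D' x -> hnorm (h x) <= 2 * hnorm d) -> square_integrable mu D (cut h).
    move=> mh hd; apply: (square_integrable_bounded (mE k) (Eoo k) (@ED k)
      (sqr_ge0 (2 * hnorm d)) (fun j => mcut h j mh) (cutN h)) => x Ex.
    rewrite cutE// -sqr_hnorm ler_sqr ?nnegrE ?mulr_ge0 ?hnorm_ge0//.
    by apply: hd; exact: (@ED' k x Ex).
  have d0 := hnorm_ge0 d.
  have [w1 w1E] : exists w1 : L2, {ae mu, forall x, w1 x = cut A x}.
    by apply: L2_class; apply: scut => // x D'x; have := Ale x D'x; lra.
  have [w2 w2E] : exists w2 : L2, {ae mu, forall x, w2 x = cut (fun x => d - A x) x}.
    apply: L2_class; apply: scut => [j|x D'x].
      rewrite (_ : (fun _ => _) = (fun x => d 0 j - A x 0 j)).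
        exact: measurable_funB.
      by apply/funext => x; rewrite !mxE.
    by have := hnormB d (A x); have := Ale x D'x; lra.
  have tw : tangent_cone graphG (u, xi) (w1, w2).
    apply: (tangent_of_ae rg propG); apply: filterS3 aeuxi w1E w2E => x ux /= -> -> Ox.
    have [Ex|Ex] := pselect (E k x).
      by rewrite !cutE//; apply: tA; exact: (@ED' k x Ex).
    by rewrite !cutN//; apply: tangent_cone0; exact: ux.
  have zw := inner_normal_tangent_le0 nz tw.
  (* A nonnegative integrand with nonpositive integral vanishes almost everywhere, yet it is
     strictly positive on [E k]; so [E k] is null. *)
  pose C x : R := if x \in E k then inner (z.1 x, z.2 x) (A x, d - A x) else 0.
  have C0 x : 0 <= C x.
    by rewrite /C; case: ifPn => // /set_mem[[_ /ltW]].
  have aeC : {ae mu, forall x, inner (z.1 x, z.2 x) (w1 x, w2 x) = C x}.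
    apply: filterS2 w1E w2E => x -> ->; rewrite /C /cut; case: ifPn => // _.
    by rewrite prod_innerE !inner0r addr0.
  have iC := integrable_L2_pair_inner z (w1, w2).
  have zwE : ((inner z (w1, w2))%:E = \int[mu]_x (inner (z.1 x, z.2 x) (w1 x, w2 x))%:E)%E.
    by rewrite L2_pair_innerE fineK//; exact: integrable_fin_num iC.
  have absE : (\int[mu]_x `|(inner (z.1 x, z.2 x) (w1 x, w2 x))%:E| =
      \int[mu]_x (inner (z.1 x, z.2 x) (w1 x, w2 x))%:E)%E.
    have mi := measurable_int mu iC.
    apply: ae_eq_integral; [exact: measurableT| |exact: mi|].
      exact: (measurable_int mu (integrable_abse iC)).
    by apply: filterS aeC => x xC _; rewrite /= xC ger0_norm.
  have int0 : (\int[mu]_x `|(inner (z.1 x, z.2 x) (w1 x, w2 x))%:E| = 0)%E.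
    rewrite absE -zwE; congr EFin; apply/eqP; rewrite eq_le zw -lee_fin zwE -absE.
    exact: integral_ge0.
  have [+ _] := @ae_eq_integral_abs _ _ _ mu _ measurableT
    (EFin \o (fun x => inner (z.1 x, z.2 x) (w1 x, w2 x))) (measurable_int mu iC).
  move=> /(_ int0); apply: filterS2 aeC => x xC /(_ I) /= [x0] Ex.
  move: xC; rewrite x0 /C mem_set// => /esym.
  by apply/eqP; rewrite gt_eqF//; case: Ex => [[]].
have aeD' : {ae mu, forall x, Omega x -> D' x}.
  exists N; split => // x /= nD'; apply: contrapT => Nx; apply: nD' => Ox.
  by split.
have := ae_foralln Enull; apply: filterS2 aeD' => x D'x nE Ox.
exists (A x); first by apply: tA; exact: D'x.
rewrite leNgt; apply/negP => zA.
have [k _ xk] : (\bigcup_k @halfopen_cube R n k) x by rewrite bigcup_halfopen_cube.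
by apply: (nE k); split => //; split => //; exact: D'x.
Qed.

End pointwise_coderivative.

Theorem corollary2p5 (R : realType) (n m : nat) (Omega : set 'rV[R]_n)
    (g : 'rV[R]_n -> 'rV[R]_m -> \bar R) :
  open Omega ->
  regular_integrand Omega g ->
  let G : L2Rn Omega m -> \bar R := integral_functional g in
  proper_ereal G ->
  forall u xi : L2Rn Omega m,
  (forall dxi : L2Rn Omega m,
    regular_coderivative (subdifferential G) u xi dxi =
    [set du : L2Rn Omega m |
      {ae lebesgueRn_measure R n, forall x, Omega x ->
        regular_coderivative (subdifferential (g x))
          (u x) (xi x) (dxi x) (du x)}]) /\
  (forall du : L2Rn Omega m,
    graphical_derivative (subdifferential G) u xi du =
    [set dxi : L2Rn Omega m |
      {ae lebesgueRn_measure R n, forall x, Omega x ->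
        graphical_derivative (subdifferential (g x))
          (u x) (xi x) (du x) (dxi x)}]).
Proof.
move=> _ rg G propG u xi; split=> [dxi|du]; apply/seteqP; split=> w /=.
(* The coderivative negates its direction, and negation in $L^2$ agrees with pointwise negation only
   almost everywhere. *)
- move=> /(ae_regular_normal rg propG); have := L2_scaleE (-1) dxi.
  by apply: filterS2 => x; rewrite /= scaleN1r => -> ; rewrite scaleN1r.
- move=> aew; apply: (regular_normal_of_ae rg propG).
  have := L2_scaleE (-1) dxi; apply: filterS2 aew => x xw.
  by rewrite /= scaleN1r => ->; rewrite scaleN1r.
- by move/(ae_tangent rg propG).
- by move=> aew; apply: (tangent_of_ae rg propG).
Qed.
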